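(* Consider the delayed projected stochastic gradient iteration described in the context, with stepsizes $\alpha(t,\tau_t)=(L+\eta(t,\tau_t))^{-1}$, $\eta(t,\tau_t)=c\sqrt{t+\tau_t}$, $c>0$, and delays following the uniform model with parameter $\bar\tau$. Let $\bar x(T)=\frac1T\sum_{t=1}^T x(t+1)$ and $f^*=f(x^* )$. Then $$\mathbb{E}[f(\bar x(T))-f^*]=\mathcal{O}\Bigl(D_1\frac{\sqrt T}{T}+D_2\frac{\log T}{T}+D_3\frac1T\Bigr),$$ where the implied constant is absolute (independent of $T$ and of all problem parameters) and $$D_1=\sqrt2\,cR^2\bar\tau+\frac{\sigma^2}{c},\qquad D_2=\frac{LG^2(4\bar\tau+3)(\bar\tau+1)}{6c^2},\qquad D_3=\frac12(L+c)R^2+\bar\tau GR+\frac{LG^2\bar\tau(\bar\tau+1)(2\bar\tau+1)^2}{6(L^2+c^2)}.$$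
   Context: Problem: minimize $f(x)=\mathbb{E}_{\xi\sim\mathbb{P}}[F(x;\xi)]$ over a nonempty compact convex set $\mathcal{X}\subset\mathbb{R}^d$, where $F(\cdot;\xi)$ is convex (and differentiable) for each $\xi$; $x^*\in\operatorname{argmin}_{x\in\mathcal{X}}f(x)$. All norms are Euclidean. Assumptions, with constants $L>0$, $\sigma,R,G\ge 0$: - $\|\nabla f(x)-\nabla f(y)\|\le L\|x-y\|$ for all $x,y\in\mathcal{X}$; - $\mathbb{E}_\xi[\|\nabla f(x)-\nabla F(x;\xi)\|^2]\le\sigma^2$ for all $x\in\mathcal{X}$; - $\max_{x\in\mathcal{X}}\|x-x^*\|\le R$; - $\|\nabla f(x)\|\le G$ for all $x\in\mathcal{X}$. Algorithm: $x(1)\in\mathcal{X}$ is given, and for $t=1,2,\dots$ $$x(t+1)=\operatorname*{argmin}_{x\in\mathcal{X}}\Bigl[\langle g(t-\tau_t),x\rangle+\frac{1}{2\alpha(t,\tau_t)}\|x-x(t)\|^2\Bigr].$$ Here $\tau_t$ is a random nonnegative-integer-valued delay with $\tau_t\le t-1$, and $g(t-\tau_t)=\nabla F(x(t-\tau_t);\xi_t)$ is an unbiased stochastic gradient at the delayed point $x(t-\tau_t)$, with $\xi_1,\xi_2,\dots$ i.i.d. from $\mathbb{P}$ and independent of the delays; the delays are mutually independent (so $x(t)$ is independent of $\tau_t$ and of $\xi_t$). Uniform delay model: $\bar\tau$ is a positive integer and $\tau_t$ is uniform on $\{0,1,\dots,2\bar\tau\}$ (for $t\le 2\bar\tau$,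 where this is incompatible with $\tau_t\le t-1$, $\tau_t$ only takes values in $\{0,\dots,t-1\}$). *)

(* Defs.v *)
From HB Require Import structures.
From mathcomp Require Import all_boot all_order all_algebra finmap.
From mathcomp Require Import all_classical all_reals all_analysis.

Set Implicit Arguments.
Unset Strict Implicit.
Unset Printing Implicit Defensive.

Import Order.TTheory GRing.Theory Num.Theory.
Import numFieldNormedType.Exports.

Local Open Scope classical_set_scope.
Local Open Scope ring_scope.

(** The norm [`|v|] that the library puts on ['rV[R]_d] is the sup norm, so the
    Euclidean inner product and norm are defined here. *)
Definition dot (R : realType) (d : nat) (u v : 'rV[R]_d) : R :=
  (u *m v^T) 0 0.

Definition enorm (R : realType) (d : nat) (v : 'rV[R]_d) : R :=
  Num.sqrt (dot v v).

Definition grad (R : realType) (d : nat) (h : 'rV[R]_d -> R) (x : 'rV[R]_d) :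
    'rV[R]_d :=
  \row_(i < d) 'D_(delta_mx 0 i) h x.

Definition argmin (R : realType) (d : nat) (X : set 'rV[R]_d)
    (h : 'rV[R]_d -> R) : set 'rV[R]_d :=
  [set x | X x /\ forall y, X y -> h x <= h y].

(** [R^d] with its Borel sigma-algebra (the library puts none on matrices). *)
Definition borel_rV (R : realType) (d : nat) :=
  g_sigma_algebraType (@open 'rV[R]_d).

(** [f x = E[F (x; xi)]] for [xi] of law [Q]; meaningful where [F x] is
    [Q]-integrable. *)
Definition objective (R : realType) (d : nat) (dX : measure_display)
    (Xi : measurableType dX) (Q : probability Xi R) (F : 'rV[R]_d -> Xi -> R)
    (x : 'rV[R]_d) : R :=
  fine 'E_Q[F x].

(** Mutual independence of the families of events [G i], [i] in [D]: the
    product rule over every finite subfamily. *)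
Definition mutually_independent (R : realType) (dO : measure_display)
    (Omega : measurableType dO) (P : probability Omega R) (I : choiceType)
    (D : set I) (G : I -> set (set Omega)) : Prop :=
  forall (J : {fset I}) (E : I -> set Omega), [set` J] `<=` D ->
    (forall i, i \in J -> G i (E i)) ->
    P (\bigcap_(i in [set` J]) E i) = (\prod_(i <- J) P (E i))%E.

(** The sigma-algebras generated by the samples [xi t] (index [inl t]) and by
    the delays [tau t] (index [inr t]). *)
Definition sample_delay_sigma (R : realType) (dO dX : measure_display)
    (Omega : measurableType dO) (P : probability Omega R)
    (Xi : measurableType dX) (xi : nat -> {RV P >-> Xi})
    (tau : nat -> {RV P >-> nat}) (i : nat + nat) : set (set Omega) :=
  match i with
  | inl t => preimage_set_system setT (xi t) measurable
  | inr t => preimage_set_system setT (tau t) measurable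
  end.

(** Time starts at [1]; the variables of index [0] are unconstrained. *)
Definition positive_time : set (nat + nat) :=
  [set i | match i with inl t | inr t => (0 < t)%N end].

(** For [t <= 2 * taubar] the law of [tau t] on [{0, ..., t - 1}] is
    arbitrary. *)
Definition uniform_delays (R : realType) (dO : measure_display)
    (Omega : measurableType dO) (P : probability Omega R) (taubar : nat)
    (tau : nat -> {RV P >-> nat}) : Prop :=
  (forall t w, (0 < t)%N -> (tau t w <= t.-1)%N) /\
  (forall t k, (2 * taubar < t)%N -> (k <= 2 * taubar)%N ->
    P (tau t @^-1` [set k]) = ((2 * taubar + 1)%:R^-1)%:E).

Definition eta (R : realType) (c : R) (t s : nat) : R :=
  c * Num.sqrt (t + s)%:R.

Definition alpha (R : realType) (L c : R) (t s : nat) : R :=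
  (L + eta c t s)^-1.

Definition delayed_sgd (R : realType) (d : nat) (dO dX : measure_display)
    (Omega : measurableType dO) (P : probability Omega R)
    (Xi : measurableType dX) (X : set 'rV[R]_d) (F : 'rV[R]_d -> Xi -> R)
    (step : nat -> nat -> R) (x1 : 'rV[R]_d)
    (xi : nat -> {RV P >-> Xi}) (tau : nat -> {RV P >-> nat})
    (x : nat -> Omega -> 'rV[R]_d) : Prop :=
  (forall w, x 1%N w = x1) /\
  (forall t w, (0 < t)%N ->
    let g := grad (F^~ (xi t w)) (x (t - tau t w)%N w) in
    argmin X
      (fun y => dot g y
                + (2 * step t (tau t w))^-1 * enorm (y - x t w) ^+ 2)
      (x t.+1 w)).

Definition xbar (R : realType) (d : nat) (Omega : Type)
    (x : nat -> Omega -> 'rV[R]_d) (T : nat) (w : Omega) : 'rV[R]_d :=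
  T%:R^-1 *: \sum_(1 <= t < T.+1) x t.+1 w.

Definition D1 (R : realType) (c sigma r : R) (taubar : nat) : R :=
  Num.sqrt 2 * c * r ^+ 2 * taubar%:R + sigma ^+ 2 / c.

Definition D2 (R : realType) (L c G : R) (taubar : nat) : R :=
  L * G ^+ 2 * (4 * taubar%:R + 3) * (taubar%:R + 1) / (6 * c ^+ 2).

Definition D3 (R : realType) (L c r G : R) (taubar : nat) : R :=
  2^-1 * (L + c) * r ^+ 2 + taubar%:R * G * r
  + L * G ^+ 2 * taubar%:R * (taubar%:R + 1) * (2 * taubar%:R + 1) ^+ 2
    / (6 * (L ^+ 2 + c ^+ 2)).

(* Main.v *)
(** Linearizing [f] at the point [y = x (t - tau t)] where the stochastic gradient
    was computed gives
      [f (x (t+1)) - f x* <= <grad f y, x (t+1) - x*> + D (x (t+1), y)]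
    with [D] the Bregman divergence of [f], so that besides the usual proximal
    estimate and a centred noise term only the expectation of [D (x (t+1), y)] has
    to be bounded. By convexity [D (z, y)] is at most both [L |z - y|^2] and
    [2 G |z - y|]. Since the proximal step does not increase the distance to a
    point of [X] beyond the contribution of the oracle, [|x s - y|^2] behaves like
    a random walk with drift: over the at most [2 m + 1] steps with stepsize of
    order [b], where [b = 1 / (L + c sqrt t)], its expectation is
    [O (b^2 (m^2 G^2 + m sigma^2))]. The quadratic bound on [D] is then used when
    [c sqrt t >= L m] and the Lipschitz bound otherwise; both yield
    [O (L m^2 G^2 / (c^2 t) + sigma^2 / (c sqrt t))]. The first [4 m] steps are
    bounded by [G r] each. *)

Require Import Defs.
From HB Require Import structures.
From mathcomp Require Import all_boot all_order all_algebra finmap.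
From mathcomp Require Import all_classical all_reals all_analysis measurable_realfun.
From mathcomp Require Import ring lra zify.

Set Implicit Arguments.
Unset Strict Implicit.
Unset Printing Implicit Defensive.

Import Order.TTheory GRing.Theory Num.Theory.
Import numFieldNormedType.Exports.

Local Open Scope classical_set_scope.
Local Open Scope ring_scope.

(** * Euclidean geometry and proximal steps *)

(** The bound to prove has no term [L * m * sigma ^+ 2 * ln T / c ^+ 2], yet the quadratic bound on
    the Bregman term, used at every step, would produce exactly that. Below the threshold
    [c * sqrt t = L * m] the Lipschitz bound is therefore linearized with a weight of order [b * m],
    which leaves only [sigma ^+ 2 * b]. Another obstacle is that the delay enters both the index of
    the oracle point and the stepsize, so the noise gets multiplied by random weights. All delays
    are put into the past: relative to it these weights are known, while the current sample is still
    fresh. The weights [L + c * sqrt (t + tau)] of the squared distances are not monotone in time.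
    Replacing them by [L + c * sqrt t] before summation costs at most [m / sqrt t] per step, and
    this is the origin of the term [c * r ^+ 2 * m * sqrt T]. Finally, iterates are given only as
    pointwise minimizers. Their measurability comes from the nonexpansiveness of the proximal
    step. *)

Section dot_product.
Context {R : realType} {d : nat}.
Implicit Types u v w : 'rV[R]_d.

Lemma dotE u v : dot u v = \sum_i u 0 i * v 0 i.
Proof. by rewrite /dot mxE; apply: eq_bigr => i _; rewrite mxE. Qed.

Lemma dotC u v : dot u v = dot v u.
Proof. by rewrite !dotE; apply: eq_bigr => i _; rewrite mulrC. Qed.

Lemma dotDl u v w : dot (u + v) w = dot u w + dot v w.
Proof. by rewrite /dot mulmxDl mxE. Qed.

Lemma dotZl (a : R) u v : dot (a *: u) v = a * dot u v.
Proof. by rewrite /dot -scalemxAl mxE. Qed.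

Lemma dotNl u v : dot (- u) v = - dot u v.
Proof. by rewrite -scaleN1r dotZl mulN1r. Qed.

Lemma dotDr u v w : dot w (u + v) = dot w u + dot w v.
Proof. by rewrite !(dotC w) dotDl. Qed.

Lemma dotZr (a : R) u v : dot u (a *: v) = a * dot u v.
Proof. by rewrite !(dotC u) dotZl. Qed.

Lemma dotNr u v : dot u (- v) = - dot u v.
Proof. by rewrite !(dotC u) dotNl. Qed.

Definition dot_bilin := (dotDl, dotDr, dotNl, dotNr, dotZl, dotZr).

Lemma dot0 : dot (0 : 'rV[R]_d) 0 = 0.
Proof. by rewrite -(scale0r 0) dotZl mul0r. Qed.

Lemma dotvv_ge0 v : 0 <= dot v v.
Proof. by rewrite dotE; apply: sumr_ge0 => i _; rewrite -expr2 sqr_ge0. Qed.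

Lemma sqr_coord_le v i : v 0 i ^+ 2 <= dot v v.
Proof.
rewrite dotE (bigD1 i) //= -expr2 lerDl.
by apply: sumr_ge0 => j _; rewrite -expr2 sqr_ge0.
Qed.

Lemma enorm_sqr v : enorm v ^+ 2 = dot v v.
Proof. by rewrite /enorm sqr_sqrtr ?dotvv_ge0. Qed.

Lemma enorm_ge0 v : 0 <= enorm v.
Proof. exact: sqrtr_ge0. Qed.

Lemma dot_young (a : R) u v : 0 < a ->
  2 * dot u v <= a * dot u u + a^-1 * dot v v.
Proof.
move=> a0; have := dotvv_ge0 (a *: u - v); rewrite !dot_bilin (dotC v u).
move=> h; rewrite -(ler_pM2l a0) mulrDr mulVKf ?gt_eqF //; nra.
Qed.

Lemma dot_le_enorm u v : dot u v <= enorm u * enorm v.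
Proof.
have [v0|v0] := eqVneq (enorm v) 0.
  have vi i : v 0 i = 0.
    have := sqr_coord_le v i; rewrite -enorm_sqr v0 expr0n /= => h.
    by apply/eqP; rewrite -sqrf_eq0 eq_le h sqr_ge0.
  by rewrite v0 mulr0 dotE big1 // => i _; rewrite vi mulr0.
have {}v0 : 0 < enorm v by rewrite lt_neqAle eq_sym v0 enorm_ge0.
have := dotvv_ge0 (enorm v ^+ 2 *: u - dot u v *: v).
rewrite !dot_bilin (dotC v u) -!enorm_sqr => h.
have {}h : dot u v ^+ 2 <= (enorm u * enorm v) ^+ 2.
  rewrite -(ler_pM2l (exprn_gt0 2 v0)); lra.
have uv0 : 0 <= enorm u * enorm v by rewrite mulr_ge0 ?enorm_ge0.
rewrite leNgt; apply/negP => lt.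
have : (enorm u * enorm v) ^+ 2 < dot u v ^+ 2 by rewrite ltrXn2r // ltW.
by rewrite ltNge h.
Qed.

Lemma enormN v : enorm (- v) = enorm v.
Proof. by rewrite /enorm !dot_bilin opprK. Qed.

Lemma enormB u v : enorm (u - v) = enorm (v - u).
Proof. by rewrite -enormN opprB. Qed.

End dot_product.

Section convex_optimization.
Context {R : realType} {d : nat}.
Implicit Types (X : set 'rV[R]_d) (u v y z g p : 'rV[R]_d) (f : 'rV[R]_d -> R).

(** Convexity with a plain real weight and an increment from [y]: the form needed both for
    difference quotients and for running averages. *)
Definition conv_on X f := forall y z h, X y -> X z -> 0 <= h -> h <= 1 ->
  f (y + h *: (z - y)) <= f y + h * (f z - f y).

Lemma convexE y z (h : R) :
  y + h *: (z - y) = h *: z + (1 - h) *: y.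
Proof. by rewrite scalerBr scalerBl scale1r [RHS]addrC addrAC addrA. Qed.

Lemma convex_setE X y z (h : R) : convex_set X -> X y -> X z -> 0 <= h -> h <= 1 ->
  X (y + h *: (z - y)).
Proof.
move=> cX Xy Xz h0 h1.
have hi : Itv.spec (Itv.num_sem (R:=R)) (Itv.Real `[0%Z, 1%Z]) h.
  by rewrite /= /Itv.num_sem num_real /= in_itv /= h0 h1.
have := cX z y (Itv.mk hi); rewrite !inE => /(_ Xz Xy).
by rewrite /conv /= convexE.
Qed.

Lemma convex_functionE X f : convex_function X f -> conv_on X f.
Proof.
move=> cf y z h Xy Xz h0 h1.
have hi : Itv.spec (Itv.num_sem (R:=R)) (Itv.Real `[0%Z, 1%Z]) h.
  by rewrite /= /Itv.num_sem num_real /= in_itv /= h0 h1.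
have := cf (Itv.mk hi) z y; rewrite !inE => /(_ Xz Xy).
rewrite /conv /= convexE => /le_trans; apply.
rewrite -[leLHS]/(h * f z + (1 - h) * f y); lra.
Qed.

Lemma derive_dot_grad f y v : differentiable f y -> 'D_v f y = dot (grad f y) v.
Proof.
move=> df; rewrite deriveE // {1}(row_sum_delta v) linear_sum dotE.
by apply: eq_bigr => i _; rewrite linearZ /= mxE deriveE // mulrC.
Qed.

Lemma convex_gradient_le X f y z : conv_on X f -> differentiable f y ->
  X y -> X z -> f y - f z <= dot (grad f y) (y - z).
Proof.
move=> cf df Xy Xz.
have := diff_derivable (v := z - y) df => /cvg_ex [l]; rewrite /= => fl.
have : 'D_(z - y) f y = l by apply: cvg_lim.
rewrite derive_dot_grad // => dl.
suff : l <= f z - f y by rewrite -dl !dot_bilin; lra.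
(* For negative [h] the point [y + h *: (z - y)] may leave [X], where convexity says nothing; hence
   the right limit. *)
have /cvg_dnbhs_at_right fl' := fl.
apply: (cvgr_to_le fl').
near=> h.
have h0 : 0 < h by near: h; exact: nbhs_right_gt.
have h1 : h <= 1 by near: h; exact: nbhs_right_le.
have := cf y z h Xy Xz (ltW h0) h1; rewrite addrC => H.
rewrite -(ler_pM2l h0) {1}/GRing.scale /= mulVKf ?gt_eqF //; lra.
Unshelve. all: by end_near. Qed.

(* First order optimality of the proximal step, obtained by comparing [z] with
   [z + h *: (u - z)] for small [h]. *)
Lemma prox_variational X g p z u (a : R) : convex_set X -> 0 < a ->
  argmin X (fun y => dot g y + (2 * a)^-1 * enorm (y - p) ^+ 2) z -> X u ->
  a * dot g (z - u) <= dot (z - p) (u - z).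
Proof.
move=> cX a0 [Xz minz] Xu.
set q := dot (u - z) (u - z); set l := a * dot g (u - z) + dot (z - p) (u - z).
have q0 : 0 <= q := dotvv_ge0 _.
have key h : 0 < h -> h <= 1 -> 0 <= 2 * l + h * q.
  move=> h0 h1; have := minz _ (convex_setE cX Xz Xu (ltW h0) h1).
  rewrite !enorm_sqr [z + _ - p]addrAC.
  rewrite /q /l; move: (z - p) => v.
  move: (u - z) => e; rewrite !dot_bilin (dotC e v) => H.
  have : 0 <= 2 * a * (h * (dot g e + (2 * a)^-1 * (2 * dot v e + h * dot e e))).
    apply: mulr_ge0; [lra|lra].
  have -> : 2 * a * (h * (dot g e + (2 * a)^-1 * (2 * dot v e + h * dot e e)))
     = h * (2 * (a * dot g e + dot v e) + h * dot e e).
    by field; rewrite gt_eqF.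
  by rewrite pmulr_rge0.
suff : 0 <= l by rewrite /l -[z - u]opprB dotNr; lra.
rewrite leNgt; apply/negP => l0.
(* If [l < 0], the choice [h = - l / (q + 1)] gives [h * q <= - l], so [2 * l + h * q <= l < 0].
   When this [h] exceeds 1, [h = 1] already contradicts [key]. *)
have [lq|ql] := leP (- l) (q + 1).
  have q1 : 0 < q + 1 by lra.
  have := key (- l / (q + 1)); rewrite ler_pdivrMr // mul1r lq divr_gt0 ?oppr_gt0 //.
  move=> /(_ isT isT).
  have : - l / (q + 1) * q <= - l.
    rewrite mulrAC ler_pdivrMr // ler_pM2l ?oppr_gt0 //; lra.
  lra.
have := key 1 ltr01 (lexx _); lra.
Qed.

(** Polarization of the variational inequality. The negative term in [z - p] is what later absorbs
    the inner products of the oracle or of its noise with [z - p]. *)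
Lemma prox_three_point X g p z u (a : R) : convex_set X -> 0 < a ->
  argmin X (fun y => dot g y + (2 * a)^-1 * enorm (y - p) ^+ 2) z -> X u ->
  2 * a * dot g (z - u) <=
    dot (p - u) (p - u) - dot (z - u) (z - u) - dot (z - p) (z - p).
Proof.
move=> cX a0 zP Xu; have := prox_variational cX a0 zP Xu.
have -> : p - u = (z - u) - (z - p) by rewrite opprB [RHS]addrC addrA subrK.
rewrite -[u - z]opprB; move: (z - p) (z - u) => s t.
rewrite !dot_bilin (dotC t s); lra.
Qed.

(** The proximal step is the projection of [p - a *: g] onto [X], so different stepsizes can be
    compared: adding the two variational inequalities bounds the squared distance by
    [dot w (z - z')]. Measurability of the iterates rests on this. *)
Lemma prox_nonexpansive X g p z (a : R) g' p' z' (a' : R) : convex_set X ->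
  0 < a -> argmin X (fun y => dot g y + (2 * a)^-1 * enorm (y - p) ^+ 2) z ->
  0 < a' -> argmin X (fun y => dot g' y + (2 * a')^-1 * enorm (y - p') ^+ 2) z' ->
  enorm (z - z') <= enorm (p - a *: g - (p' - a' *: g')).
Proof.
move=> cX a0 zP a'0 zP'.
have [Xz _] := zP; have [Xz' _] := zP'.
have h1 := prox_variational cX a0 zP Xz'.
have h2 := prox_variational cX a'0 zP' Xz.
set w := p - a *: g - _.
have zw : enorm (z - z') ^+ 2 <= dot w (z - z').
  rewrite enorm_sqr; move: h1 h2; rewrite /w.
  have -> : z' - z = - (z - z') by rewrite opprB.
  have -> : dot (z - p) (- (z - z')) = dot (p - z) (z - z').
    by rewrite dotNr -dotNl opprB.
  move vE: (z - z') => v; rewrite !dot_bilin.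
  have : dot z v - dot z' v = dot v v by rewrite -dotNl -dotDl vE.
  rewrite -!(dotC v); lra.
have [->|n0] := eqVneq (enorm (z - z')) 0; first exact: enorm_ge0.
rewrite -(@ler_pM2r _ (enorm (z - z'))) -?expr2; last first.
  by rewrite lt_neqAle eq_sym n0 enorm_ge0.
exact: le_trans zw (dot_le_enorm _ _).
Qed.

Definition bregman f y z := f y - f z - dot (grad f z) (y - z).

(** Convexity at [y] bounds the divergence by [dot (grad f y - grad f z) (y - z)]. The constant is
    [L] instead of [L / 2], but no integration along the segment is involved. *)
Lemma bregman_smooth X f (L : R) y z : conv_on X f ->
  (forall y, X y -> differentiable f y) ->
  (forall y z, X y -> X z -> enorm (grad f y - grad f z) <= L * enorm (y - z)) ->
  X y -> X z -> bregman f y z <= L * dot (y - z) (y - z).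
Proof.
move=> cf df lf Xy Xz.
have h1 := convex_gradient_le cf (df _ Xy) Xy Xz.
have h2 := dot_le_enorm (grad f y - grad f z) (y - z).
have h3 := ler_wpM2r (enorm_ge0 (y - z)) (lf _ _ Xy Xz).
rewrite /bregman -enorm_sqr expr2.
move: h2 h3; rewrite dotDl dotNl; lra.
Qed.

Lemma bregman_lipschitz X f (G : R) y z : conv_on X f ->
  (forall y, X y -> differentiable f y) ->
  (forall y, X y -> enorm (grad f y) <= G) ->
  X y -> X z -> bregman f y z <= 2 * G * enorm (y - z).
Proof.
move=> cf df gf Xy Xz.
have h1 := convex_gradient_le cf (df _ Xy) Xy Xz.
have h2 := dot_le_enorm (grad f y) (y - z).
have h3 := dot_le_enorm (grad f z) (z - y).
have h4 := ler_wpM2r (enorm_ge0 (y - z)) (gf _ Xy).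
have h5 := ler_wpM2r (enorm_ge0 (y - z)) (gf _ Xz).
rewrite /bregman; move: h3; rewrite (enormB z y) -[z - y]opprB dotNr; lra.
Qed.

(* The delayed gradient is handled by linearizing [f] at the point [y] where
   it was computed, so that only the Bregman term from [y] to [z] remains. *)
Lemma prox_descent X f g p z u y (a : R) : convex_set X -> conv_on X f ->
  (forall y, X y -> differentiable f y) -> 0 < a ->
  argmin X (fun y => dot g y + (2 * a)^-1 * enorm (y - p) ^+ 2) z ->
  X u -> X y ->
  f z - f u <= (2 * a)^-1 * (dot (p - u) (p - u) - dot (z - u) (z - u))
    + dot (grad f y - g) (p - u)
    + a / 2 * dot (grad f y - g) (grad f y - g) + bregman f z y.
Proof.
move=> cX cf df a0 zP Xu Xy; have [Xz _] := zP.
have h1 := prox_three_point cX a0 zP Xu.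
have h2 := convex_gradient_le cf (df _ Xy) Xy Xu.
have h3 := dot_young (grad f y - g) (z - p) a0.
have h4 : dot g (z - u) <= (2 * a)^-1 * (dot (p - u) (p - u)
    - dot (z - u) (z - u)) - a^-1 / 2 * dot (z - p) (z - p).
  rewrite -(@ler_pM2l _ (2 * a)); last by lra.
  apply: le_trans h1 _; rewrite mulrBr mulVKf; last by rewrite mulf_neq0 // gt_eqF.
  have -> : 2 * a * (a^-1 / 2 * dot (z - p) (z - p)) = dot (z - p) (z - p).
    by field; rewrite gt_eqF.
  by [].
(* The part of the noise paired with [p - u] will average out because [p] precedes the sample; the
   part paired with [z - p] is paid by [h3] and the negative term of [h4]. *)
have h5 : dot (grad f y - g) (z - u) = dot (grad f y - g) (z - p)
    + dot (grad f y - g) (p - u) by rewrite -dotDr addrA subrK.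
rewrite /bregman; move: h2 h4 h5.
have -> : z - y = (z - u) - (y - u) by rewrite opprB addrA subrK.
rewrite [dot (_ - g) (z - u)]dotDl [dot (- g) (z - u)]dotNl.
rewrite [dot (grad f y) (_ - (y - u))]dotDr dotNr; lra.
Qed.

(** Here [w] is the true gradient and [w - g] the noise. The drift of [w] is split by Young with
    weight [2 * M], so that the growth factor stays harmless when compounded over [M] steps. The
    stepsize sits inside the vector paired with the noise because it will be random. *)
Lemma prox_drift X g p z u w (a G M : R) : convex_set X -> 0 < a -> 0 < M ->
  argmin X (fun y => dot g y + (2 * a)^-1 * enorm (y - p) ^+ 2) z ->
  X u -> 0 <= G -> enorm w <= G ->
  dot (z - u) (z - u) <= (1 + (2 * M)^-1) * dot (p - u) (p - u)
    + 2 * dot (w - g) (a *: (p - u)) + a ^+ 2 * (2 * M + 2) * G ^+ 2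
    + 2 * a ^+ 2 * dot (w - g) (w - g).
Proof.
move=> cX a0 M0 zP Xu G0 wG.
have h1 := prox_three_point cX a0 zP Xu.
have h2 := dot_young g (p - z) a0.
have M20 : 0 < 2 * M by lra.
have h3 : - (2 * a * dot w (p - u)) <= (2 * M)^-1 * dot (p - u) (p - u)
     + 2 * M * (a ^+ 2 * dot w w).
  by have := dot_young (- a *: w) (p - u) M20; rewrite !dot_bilin; lra.
have h4 : dot w w <= G ^+ 2 by rewrite -enorm_sqr lerXn2r ?nnegrE ?enorm_ge0.
have h5 : dot g g <= 2 * dot w w + 2 * dot (w - g) (w - g).
  by have := dotvv_ge0 (w + (w - g)); rewrite !dot_bilin (dotC g w); lra.
have h6 : a ^+ 2 * dot g g <= a ^+ 2 * (2 * G ^+ 2 + 2 * dot (w - g) (w - g)).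
  by rewrite ler_wpM2l ?sqr_ge0 //; lra.
have h7 : 2 * M * (a ^+ 2 * dot w w) <= 2 * M * (a ^+ 2 * G ^+ 2).
  by rewrite !ler_wpM2l ?sqr_ge0 // ltW.
have h8 : a * (2 * dot g (p - z)) <= a ^+ 2 * dot g g + dot (z - p) (z - p).
  rewrite -[z - p]opprB [dot (- _) _]dotNl dotNr opprK.
  apply: le_trans (ler_wpM2l (ltW a0) h2) _.
  by rewrite mulrDr mulVKf ?gt_eqF // expr2 mulrA.
have h9 : dot g (z - u) = dot g (p - u) - dot g (p - z).
  by rewrite -dotNr -dotDr opprB [p - u + _]addrC addrA subrK.
move: h1 h3; rewrite h9 dotZr [dot (w - g) (p - u)]dotDl dotNl; lra.
Qed.

End convex_optimization.

(** * Borel measurability in R^d *)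

Lemma continuous_enormB (R : realType) d (y : 'rV[R]_d) :
  continuous (fun z : 'rV[R]_d => enorm (y - z)).
Proof.
have cB i : continuous (fun z : 'rV[R]_d => (y - z) 0 i).
  have -> : (fun z : 'rV[R]_d => (y - z) 0 i) = (fun z => y 0 i - z 0 i).
    by apply/funext => z; rewrite !mxE.
  move=> z; apply: (@cvgB R _ _ (nbhs z) _ (fun=> y 0 i) (fun z => z 0 i)).
    exact: cvg_cst.
  exact: coord_continuous.
have cS s : continuous (fun z : 'rV[R]_d =>
    \sum_(i <- s) (y - z) 0 i * (y - z) 0 i).
  elim: s => [|i s IHs].
    have -> : (fun z : 'rV[R]_d => \sum_(i <- [::]) (y - z) 0 i * (y - z) 0 i) = cst 0.
      by apply/funext => z; rewrite big_nil.
    exact: cst_continuous.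
  have -> : (fun z : 'rV[R]_d => \sum_(j <- i :: s) (y - z) 0 j * (y - z) 0 j) =
      (fun z => (y - z) 0 i * (y - z) 0 i + \sum_(j <- s) (y - z) 0 j * (y - z) 0 j).
    by apply/funext => z; rewrite big_cons.
  move=> z; apply: (@cvgD R _ _ (nbhs z) _ (fun z => (y - z) 0 i * (y - z) 0 i)
    (fun z => \sum_(j <- s) (y - z) 0 j * (y - z) 0 j)); last exact: IHs.
  by apply: (@cvgM R _ (nbhs z) _ (fun z => (y - z) 0 i) (fun z => (y - z) 0 i));
    exact: cB.
have -> : (fun z : 'rV[R]_d => enorm (y - z)) =
    Num.sqrt \o (fun z => \sum_i (y - z) 0 i * (y - z) 0 i).
  by apply/funext => z; rewrite /enorm dotE.
by move=> z; apply: continuous_comp; [exact: cS|exact: sqrt_continuous].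
Qed.

Section borel_vectors.
Context {R : realType} {d : nat}.

(** Cubes with rational centre and inverse-integer radius: a countable base of the topology. *)
Definition box (q : 'rV[rat]_d) (n : nat) : set 'rV[R]_d :=
  [set z | forall i, `|z 0 i - ratr (q 0 i)| < n.+1%:R^-1].

Lemma open_box_cover (U : set 'rV[R]_d) : open U ->
  U = \bigcup_(qn in [set qn | box qn.1 qn.2 `<=` U]) box qn.1 qn.2.
Proof.
move=> oU; rewrite eqEsubset; split=> [y Uy|y [qn /= qnU /qnU]//].
have /nbhs_ballP[e /= e0 yeU] : nbhs y U by exact: open_nbhs_nbhs.
have e2 : 0 < e / 2 by lra.
have [n _ /(_ n (leqnn n)) /= ne] := near_infty_natSinv_lt (PosNum e2).
have n0 : 0 < n.+1%:R^-1 :> R by rewrite invr_gt0.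
have /choice [r rP] : forall i : 'I_d, exists r : rat, `|y 0 i - ratr r| < n.+1%:R^-1.
  move=> i; have : y 0 i - n.+1%:R^-1 < y 0 i + n.+1%:R^-1.
    by rewrite ltrBlDr -addrA ltrDl addr_gt0.
  move=> /rat_in_itvoo[r]; rewrite in_itv /= => /andP[h1 h2]; exists r.
  by rewrite ltr_norml; move: n.+1%:R^-1 h1 h2 => a h1 h2; apply/andP; split; lra.
exists (\row_i r i, n) => /= [z zq|i]; last by rewrite mxE.
apply: yeU; split=> // i j; rewrite (ord1 i) /ball /=.
have := zq j; have := rP j; rewrite mxE !ltr_norml; move: n.+1%:R^-1 ne => a ne.
move=> /andP[? ?] /andP[? ?].
by apply/andP; split; lra.
Qed.

End borel_vectors.

Section borel_measurability.
Context {R : realType} d0 (T : measurableType d0).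

(** An open set is a countable union of boxes, and the preimage of a box is a finite intersection of
    coordinate preimages of intervals. *)
Lemma measurable_vectorP d (h : T -> 'rV[R]_d) :
  (forall i, measurable_fun setT (fun w => h w 0 i)) ->
  measurable_fun setT (h : T -> borel_rV R d).
Proof.
move=> mh; apply: (@measurability _ _ T (borel_rV R d) setT _ (@open 'rV[R]_d)) => //.
move=> _ [U oU <-]; rewrite setTI (open_box_cover oU) preimage_bigcup bigcup_mkcond.
apply: countable_bigcupT_measurable => // qn; case: ifPn => // _.
rewrite (_ : _ @^-1` _ = \bigcap_(i in [set: 'I_d])
  ((fun w => h w 0 i) @^-1` `](ratr (qn.1 0 i) - qn.2.+1%:R^-1),
    (ratr (qn.1 0 i) + qn.2.+1%:R^-1)[%classic)); last first.
  by apply/seteqP; split=> w /= H i; [move=> _|have := H i I];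
    have := H i; rewrite /= in_itv /= -ltr_distl // => /(_ I).
apply: fin_bigcap_measurable => // i _.
by rewrite -[X in measurable X]setTI; exact: mh.
Qed.

Lemma measurable_coord d (h : T -> 'rV[R]_d) i :
  measurable_fun setT (h : T -> borel_rV R d) ->
  measurable_fun setT (fun w => h w 0 i).
Proof.
move=> mh; apply: (measurability _ (RGenOpens.measurableE R)).
move=> _ [_ [a [b ->] <-]]; rewrite setTI.
have -> : (fun w => h w 0 i) @^-1` `]a, b[%classic =
  setT `&` h @^-1` ((fun z : 'rV[R]_d => z 0 i) @^-1` `]a, b[%classic) by rewrite setTI.
apply: mh => //; apply: sub_sigma_algebra.
have /continuousP := @coord_continuous R 1 d 0 i; apply.
exact: interval_open.
Qed.

Lemma measurable_dot d (h k : T -> 'rV[R]_d) :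
  measurable_fun setT (h : T -> borel_rV R d) ->
  measurable_fun setT (k : T -> borel_rV R d) ->
  measurable_fun setT (fun w => dot (h w) (k w)).
Proof.
move=> mh mk; under eq_fun do rewrite dotE.
by apply: measurable_sum => i; apply: measurable_funM; exact: measurable_coord.
Qed.

Lemma measurable_scalev d (a : T -> R) (k : T -> 'rV[R]_d) :
  measurable_fun setT a ->
  measurable_fun setT (k : T -> borel_rV R d) ->
  measurable_fun setT ((fun w => a w *: k w) : T -> borel_rV R d).
Proof.
move=> ma mk; apply: measurable_vectorP => i; under eq_fun do rewrite mxE.
by apply: measurable_funM => //; exact: measurable_coord.
Qed.

Lemma measurable_subv d (h k : T -> 'rV[R]_d) :
  measurable_fun setT (h : T -> borel_rV R d) ->
  measurable_fun setT (k : T -> borel_rV R d) ->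
  measurable_fun setT ((fun w => h w - k w) : T -> borel_rV R d).
Proof.
move=> mh mk; apply: measurable_vectorP => i; under eq_fun do rewrite !mxE.
by apply: measurable_funB; exact: measurable_coord.
Qed.

(* [q] factors through a Lipschitz map defined on the range of [p] only. *)
Lemma measurable_lipschitz_factor n d (p : T -> 'rV[R]_n) (q : T -> 'rV[R]_d) (K : R) :
  0 < K -> (forall w w', enorm (q w - q w') <= K * enorm (p w - p w')) ->
  measurable_fun setT (p : T -> borel_rV R n) ->
  measurable_fun setT (q : T -> borel_rV R d).
Proof.
move=> K0 lip mp; apply: (@measurability _ _ T (borel_rV R d) setT _ (@open 'rV[R]_d)) => //.
move=> _ [U oU <-]; rewrite setTI.
have near_U w : U (q w) -> exists2 e : R, 0 < e & forall z, enorm (q w - z) < e -> U z.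
  move=> Uq; have /nbhs_ballP[e /= e0 yeU] : nbhs (q w) U by exact: open_nbhs_nbhs.
  exists e => // z ze; apply: yeU; split=> // i j.
  rewrite (ord1 i) /ball /=; apply: le_lt_trans ze.
  rewrite -sqrtr_sqr ler_sqrt ?dotvv_ge0 //.
  by have := sqr_coord_le (q w - z) j; rewrite !mxE.
(* One ball of radius [e / K] around [p w] for each Euclidean ball of radius [e] around [q w] inside
   [U]. [V] is open in the whole space, so the range of [p] need not be measurable. *)
pose V := \bigcup_(we in [set we : T * R | 0 < we.2 /\
    forall z, enorm (q we.1 - z) < we.2 -> U z])
  [set z | enorm (p we.1 - z) < we.2 / K].
have oV : open V.
  apply: bigcup_open => -[w e] _ /=.
  have /continuousP := @continuous_enormB _ _ (p w).
  move=> /(_ `]-oo, (e / K)[%classic (interval_open _ _)).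
  rewrite (_ : _ @^-1` _ = [set z | enorm (p w - z) < e / K]); first exact.
  by apply/seteqP; split=> z /=; rewrite in_itv.
have -> : q @^-1` U = setT `&` p @^-1` V.
  rewrite setTI; apply/seteqP; split=> [w /= Uq|w' [[w e] /= [e0 He] pw]].
    have [e e0 He] := near_U w Uq; exists (w, e) => //=.
    by rewrite subrr /enorm dot0 sqrtr0 divr_gt0.
  apply: He; apply: le_lt_trans (lip _ _) _.
  by rewrite mulrC -ltr_pdivlMr.
by apply: mp => //; exact: sub_sigma_algebra.
Qed.

Lemma measurable_switch d' (T' : measurableType d') (k : T -> nat) (h : nat -> T -> T') :
  measurable_fun setT k -> (forall j, measurable_fun setT (h j)) ->
  measurable_fun setT (fun w => h (k w) w).
Proof.
move=> mk mh _ A mA; rewrite setTI.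
have -> : (fun w => h (k w) w) @^-1` A = \bigcup_j (k @^-1` [set j] `&` h j @^-1` A).
  by rewrite eqEsubset; split=> [w /= Aw|w [j _ [/= <-]]//]; exists (k w).
apply: bigcupT_measurable => j; apply: measurableI; rewrite -[X in measurable X]setTI.
  exact: mk.
exact: mh.
Qed.

End borel_measurability.

(** * Freezing an independent variable *)

Lemma integral_probability_cst (R : realType) dT (T : measurableType dT)
  (P : probability T R) (k : R) : (\int[P]_w k%:E = k%:E)%E.
Proof.
rewrite -[RHS]mule1 -(probability_setT P).
exact: (integral_cst P measurableT k%:E).
Qed.

Section freezing.
Context {R : realType} d0 dS dX (Omega : measurableType d0) (S : measurableType dS)
  (Xi : measurableType dX) (P : probability Omega R) (Q : probability Xi R).
Variables (Y : {RV P >-> S}) (xi : {RV P >-> Xi}).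
Hypothesis lawxi : forall B, measurable B -> distribution P xi B = Q B.
Hypothesis indep : forall A B, measurable A -> measurable B ->
  P (Y @^-1` A `&` xi @^-1` B) = (P (Y @^-1` A) * P (xi @^-1` B))%E.
Local Open Scope ereal_scope.

(** By independence the pair has the product law, and Tonelli applies. In the application [S] is the
    sample space with the sigma-algebra of the past and [Y] is the identity. *)
Lemma indep_ge0_integral (f : S * Xi -> \bar R) :
  measurable_fun setT f -> (forall z, 0 <= f z) ->
  \int[P]_w f (Y w, xi w) = \int[P]_w \int[Q]_s f (Y w, s).
Proof.
move=> mf f0.
have mZ : measurable_fun setT (fun w => (Y w, xi w)).
  exact: measurable_fun_pair.
pose Z : {RV P >-> (S * Xi)%type} :=
  HB.pack_for {mfun Omega >-> (S * Xi)%type} (fun w => (Y w, xi w))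
    (isMeasurableFun.Build _ _ _ _ (fun w => (Y w, xi w)) mZ).
transitivity (\int[distribution P Z]_z f z).
  by rewrite ge0_integral_distribution.
transitivity (\int[distribution P Y \x Q]_z f z).
  apply: eq_measure_integral => A mA _; apply/esym.
  apply: product_measure_unique => // B C mB mC.
  rewrite /= -lawxi // /distribution /pushforward -indep //.
rewrite fubini_tonelli1 //.
rewrite ge0_integral_distribution //; first exact: measurable_fun_fubini_tonelli_F.
by move=> y; exact: integral_ge0.
Qed.

Lemma indep_ge0_integral_le (f : S * Xi -> \bar R) (K : R) :
  measurable_fun setT f -> (forall z, 0 <= f z) ->
  (forall w, \int[Q]_s f (Y w, s) <= K%:E) ->
  \int[P]_w f (Y w, xi w) <= K%:E.
Proof.
move=> mf f0 fK; rewrite indep_ge0_integral //.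
apply: (@le_trans _ _ (\int[P]_w K%:E)); last first.
  by rewrite integral_probability_cst.
have int0 w : 0 <= \int[Q]_s f (Y w, s) by exact: integral_ge0.
apply: ge0_le_integral => //.
have mF : measurable_fun setT (fubini_F Q f) by exact: measurable_fun_fubini_tonelli_F.
exact: (measurableT_comp mF (measurable_funP Y)).
Qed.

(** Positive and negative parts are frozen separately; their inner integrals are finite and agree,
    since the inner integral of [f] vanishes. *)
Lemma indep_integral0 (f : S * Xi -> R) : measurable_fun setT f ->
  P.-integrable setT (fun w => (f (Y w, xi w))%:E) ->
  (forall w, Q.-integrable setT (fun s => (f (Y w, s))%:E)) ->
  (forall w, \int[Q]_s (f (Y w, s))%:E = 0) ->
  \int[P]_w (f (Y w, xi w))%:E = 0.
Proof.
move=> mf intf intfQ f0.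
have mEf : measurable_fun setT (EFin \o f) by exact/measurable_EFinP.
transitivity (\int[P]_w (EFin \o f)^\+ (Y w, xi w) -
              \int[P]_w (EFin \o f)^\- (Y w, xi w)); first
  by rewrite integralE; congr (_ - _); apply: eq_integral => w _;
     rewrite ?funeposE ?funenegE.
rewrite (indep_ge0_integral (measurable_funepos mEf)) //.
rewrite (indep_ge0_integral (measurable_funeneg mEf)) //.
have pos_neg w : \int[Q]_s (EFin \o f)^\+ (Y w, s) = \int[Q]_s (EFin \o f)^\- (Y w, s).
  have posE : \int[Q]_s (EFin \o f)^\+ (Y w, s) =
      \int[Q]_s (fun s => (f (Y w, s))%:E)^\+ s.
    by apply: eq_integral => s _; rewrite !funeposE.
  have negE : \int[Q]_s (EFin \o f)^\- (Y w, s) =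
      \int[Q]_s (fun s => (f (Y w, s))%:E)^\- s.
    by apply: eq_integral => s _; rewrite !funenegE.
  have := f0 w; rewrite integralE -posE -negE => /eqP.
  have pf : \int[Q]_s (EFin \o f)^\+ (Y w, s) \is a fin_num.
    by rewrite posE; exact: (integrable_pos_fin_num measurableT (intfQ w)).
  have nf : \int[Q]_s (EFin \o f)^\- (Y w, s) \is a fin_num.
    by rewrite negE; exact: (integrable_neg_fin_num measurableT (intfQ w)).
  by rewrite sube_eq ?add0e ?fin_num_adde_defl // => /eqP.
under eq_integral do rewrite pos_neg.
rewrite subee //.
rewrite -(indep_ge0_integral (measurable_funeneg mEf)) //.
rewrite [X in X \is a _](_ : _ = \int[P]_w (fun w => (f (Y w, xi w))%:E)^\- w).
  exact: (integrable_neg_fin_num measurableT intf).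
by apply: eq_integral => w _; rewrite !funenegE.
Qed.

End freezing.

(** The measures sending [A] to [P (A]&[D)] and to [P A * P D] agree on a generating family stable
    under intersection, hence on the generated sigma-algebra. *)
Lemma indep_g_sigma (R : realType) d0 (Omega : measurableType d0)
    (P : probability Omega R) (G : set (set Omega)) (D : set Omega) :
  G `<=` measurable -> setI_closed G -> G setT -> measurable D ->
  (forall A, G A -> P (A `&` D) = (P A * P D)%E) ->
  forall A, <<s G >> A -> P (A `&` D) = (P A * P D)%E.
Proof.
move=> Gm GI GT mD GD A sA.
have PD : P D \is a fin_num by rewrite fin_num_measure.
have k0 : 0 <= fine (P D) by exact: fine_ge0.
transitivity (mscale (NngNum k0) P A); last by rewrite /mscale /= fineK // muleC.
transitivity (mrestr P mD A) => //.
apply: (@g_sigma_algebra_measure_unique _ R Omega G Gm (fun _ => setT)) => //.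
- by apply/seteqP; split=> // w _; exists 0%N.
- move=> B GB; rewrite -[LHS]/(P (B `&` D)) -[RHS]/((fine (P D))%:E * P B)%E.
  by rewrite GD // fineK // muleC.
- by move=> _; rewrite -[ltLHS]/(P (setT `&` D)) setTI ltey_eq PD.
Qed.

(** * The filtration of the algorithm *)

Section filtration.
Context {R : realType} {d0 dX : measure_display} {Omega : measurableType d0}
  {P : probability Omega R} {Xi : measurableType dX}.
Variables (xi : nat -> {RV P >-> Xi}) (tau : nat -> {RV P >-> nat}).
Local Notation sds := (sample_delay_sigma xi tau).

(* All the delays, future ones included, belong to the past of time [t]: only
   the samples have to be revealed progressively. *)
Definition past (t : nat) : set (nat + nat) :=
  [set i | match i with inl s => (0 < s < t)%N | inr s => (0 < s)%N end].

(** Finite intersections, not single events: they form a pi-system, and mutual independence speaks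
    of them directly. *)
Definition past_events (t : nat) : set (set Omega) :=
  [set A | exists (J : {fset nat + nat}) (E : nat + nat -> set Omega),
    [/\ [set` J] `<=` past t, (forall i, i \in J -> sds i (E i)) &
        A = \bigcap_(i in [set` J]) E i]].

Lemma sdsI i A B : sds i A -> sds i B -> sds i (A `&` B).
Proof.
by case: i => s /= [A' mA' <-] [B' mB' <-]; exists (A' `&` B');
  [exact: measurableI|rewrite preimage_setI setIACA setIid|
   exact: measurableI|rewrite preimage_setI setIACA setIid].
Qed.

Lemma sdsT i : sds i setT.
Proof. by case: i => s; exists setT; rewrite // preimage_setT setTI. Qed.

Lemma sds_measurable i A : sds i A -> measurable A.
Proof. by case: i => s /= [A' mA' <-]; exact: measurable_funP. Qed.

Lemma past_events_measurable t : past_events t `<=` measurable.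
Proof.
move=> _ [J [E [_ sE ->]]]; apply: fin_bigcap_measurable => [|i /= iJ].
  exact: finite_fset.
exact: sds_measurable (sE i iJ).
Qed.

Lemma past_eventsI t : setI_closed (past_events t).
Proof.
move=> _ _ [J1 [E1 [J1t sE1 ->]]] [J2 [E2 [J2t sE2 ->]]].
(* Each family is padded with [setT] outside its own index set, so that both can be indexed by the
   union. *)
pose E (J : {fset nat + nat}) (E : nat + nat -> set Omega) i :=
  if i \in J then E i else setT.
exists (J1 `|` J2)%fset, (fun i => E J1 E1 i `&` E J2 E2 i); split.
- by move=> i /=; rewrite inE => /orP[/J1t|/J2t].
- move=> i _; apply: sdsI; rewrite /E; case: ifPn => ? //; try exact: sdsT.
    exact: sE1.
  exact: sE2.
- rewrite /E; apply/seteqP; split=> [w [w1 w2] i _|w wE].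
    by split; case: ifPn => // ?; [exact: w1|exact: w2].
  by split=> i /= iJ; have := wE i; rewrite /= inE iJ ?orbT => /(_ isT) [].
Qed.

Lemma past_eventsT t : past_events t setT.
Proof.
exists fset0, (fun=> setT); split; first by move=> i.
  by move=> i; rewrite inE.
by apply/seteqP; split.
Qed.

Lemma past_events_gen t i A : past t i -> sds i A -> past_events t A.
Proof.
move=> it sA; exists [fset i]%fset, (fun=> A); split.
- by move=> j /=; rewrite inE => /eqP ->.
- by move=> j; rewrite inE => /eqP ->.
- by apply/seteqP; split=> [w wA j _//|w /(_ i)]; apply; rewrite /= inE.
Qed.

Lemma past_events_le s t : (s <= t)%N -> past_events s `<=` past_events t.
Proof.
move=> st A [J [E [Js sE AE]]]; exists J, E; split=> // i /Js.
by case: i => // i /= /andP[-> /=] /leq_trans; exact.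
Qed.

(** The sample space retyped with the sigma-algebra of the past, so that being adapted is ordinary
    measurability out of [filt t]. *)
Definition filt (t : nat) := g_sigma_algebraType (past_events t).

Lemma past_le_measurable t : <<s past_events t >> `<=` @measurable _ Omega.
Proof.
apply: smallest_sub; first exact: sigma_algebra_measurable.
exact: past_events_measurable.
Qed.

Lemma filt_le s t d' (T' : measurableType d') (h : Omega -> T') : (s <= t)%N ->
  measurable_fun setT (h : filt s -> T') -> measurable_fun setT (h : filt t -> T').
Proof.
move=> st mh _ A mA; have := mh measurableT A mA; apply: sub_sigma_algebra2.
exact: past_events_le.
Qed.

Lemma filt_measurable t d' (T' : measurableType d') (h : Omega -> T') :
  measurable_fun setT (h : filt t -> T') -> measurable_fun setT h.
Proof.
by move=> mh _ A mA; apply: past_le_measurable (mh measurableT A mA).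
Qed.

Lemma filt_xi s t : (0 < s < t)%N -> measurable_fun setT (xi s : filt t -> Xi).
Proof.
move=> st _ A mA; apply: sub_sigma_algebra.
by apply: (@past_events_gen t (inl s)) => //; exists A.
Qed.

Lemma filt_tau s t : (0 < s)%N -> measurable_fun setT (tau s : filt t -> nat).
Proof.
move=> st _ A mA; apply: sub_sigma_algebra.
by apply: (@past_events_gen t (inr s)) => //; exists A.
Qed.

Hypothesis indep : mutually_independent P positive_time sds.

(** On the generators, the index [inl t] lies outside [past t]; the product rule for [J] with this
    index added, compared with the rule for [J], gives the claim. *)
Lemma past_indep t A B : (0 < t)%N -> <<s past_events t >> A -> measurable B ->
  P (A `&` xi t @^-1` B) = (P A * P (xi t @^-1` B))%E.
Proof.
move=> t0 sA mB; have mD : measurable (xi t @^-1` B).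
  by rewrite -[X in measurable X]setTI; exact: measurable_funP.
apply: indep_g_sigma sA => //.
- exact: past_events_measurable.
- exact: past_eventsI.
- exact: past_eventsT.
move=> _ [J [E [Jt sE ->]]].
have tJ : inl t \notin J.
  by apply/negP => /Jt /=; rewrite ltnn andbF.
pose E' i := if i == inl t then xi t @^-1` B else E i.
have E'E i : i \in J -> E' i = E i.
  by rewrite /E'; case: eqP => // ->; rewrite (negbTE tJ).
have Jpos : [set` J] `<=` positive_time.
  by case=> s /Jt //= /andP[].
have -> : \bigcap_(i in [set` J]) E i `&` xi t @^-1` B =
    \bigcap_(i in [set` (inl t |` J)%fset]) E' i.
  apply/seteqP; split=> [w [wE wB] i /=|w wE].
    rewrite !inE => /orP[/eqP ->|iJ]; first by rewrite /E' eqxx.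
    by rewrite E'E //; exact: wE.
  split=> [i /= iJ|].
    by rewrite -E'E //; apply: wE; rewrite /= !inE iJ orbT.
  by have := wE (inl t); rewrite /E' eqxx; apply; rewrite /= fset1U1.
rewrite (@indep (inl t |` J)%fset E'); last 2 first.
- by move=> i /= /fset1UP[->//|/Jpos].
- move=> i /fset1UP[->|iJ]; last by rewrite E'E //; exact: sE.
  by rewrite /E' eqxx; exists B; rewrite ?setTI.
rewrite big_fsetU1 //= (_ : E' (inl t) = xi t @^-1` B); last by rewrite /E' eqxx.
rewrite muleC (indep Jpos sE); congr (_ * _)%E.
by apply: eq_big_seq => i iJ; rewrite E'E.
Qed.

End filtration.

(** * Elementary sums and bounds in mean *)

Section sums.
Context {R : realType}.

Lemma sum_le_telescope (h g : nat -> R) (a T : nat) : (0 < a)%N ->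
  (forall t, (a <= t)%N -> h t <= g t - g t.-1) -> (forall t, 0 <= g t) ->
  \sum_(a <= t < T.+1) h t <= g T.
Proof.
move=> a0 hg g0; elim: T => [|T IH]; first by rewrite big_geq.
have [aT|Ta] := leqP a T.+1; last by rewrite big_geq.
rewrite big_nat_recr //=; have := hg _ aT => /=; lra.
Qed.

(** [ln (1 + u) <= u] at [u = - t^-1] yields [t^-1 <= ln t - ln (t - 1)]. Starting at 2 or later
    avoids an additive constant. *)
Lemma sum_inv_le_ln (a T : nat) : (1 < a)%N ->
  \sum_(a <= t < T.+1) (t%:R^-1 : R) <= ln T%:R.
Proof.
move=> a1; apply: (sum_le_telescope (g := fun t => ln t%:R)) => [|t at_|t].
- exact: ltnW.
- case: t at_ => [|[|t]]; rewrite ?leqn0; try by case: (a) a1 => [|[]].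
  move=> _ /=; set y : R := t.+1%:R; set z : R := t.+2%:R.
  have zy : z = y + 1 by rewrite /z -natr1.
  have y0 : 0 < y by rewrite ltr0n.
  have z0 : 0 < z by lra.
  have zi : - 1 < - z^-1 by rewrite ltrN2 invf_lt1 //; lra.
  have := le_ln1Dx zi; have -> : 1 + - z^-1 = y / z.
    by rewrite -[1](@mulfV _ z) ?gt_eqF // -{2}[z^-1]mul1r -mulrBl zy addrK.
  by rewrite ln_div ?posrE // -[in X in _ -> X]lerN2 opprB.
- case: t => [|t]; first by rewrite ln0.
  by rewrite ln_ge0 // ler1n.
Qed.

Lemma sum_inv_sqrt_le (a T : nat) : (0 < a)%N ->
  \sum_(a <= t < T.+1) ((Num.sqrt t%:R)^-1 : R) <= 2 * Num.sqrt T%:R.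
Proof.
move=> a0; apply: (sum_le_telescope (g := fun t => 2 * Num.sqrt t%:R)) => // t.
case: t => [|t] at_; first by case: (a) a0 at_.
rewrite /= -(ler_pM2l (_ : 0 < Num.sqrt t.+1%:R)) ?sqrtr_gt0 ?ltr0n //.
rewrite mulfV ?gt_eqF ?sqrtr_gt0 ?ltr0n //.
have h1 : Num.sqrt t.+1%:R ^+ 2 = t%:R + 1 :> R by rewrite sqr_sqrtr ?natr1.
have h2 : Num.sqrt t%:R ^+ 2 = t%:R :> R by rewrite sqr_sqrtr.
have := sqr_ge0 (Num.sqrt t.+1%:R - Num.sqrt t%:R : R); nra.
Qed.

Lemma abel_le (c D : nat -> R) (B : R) (a T : nat) : (0 < a)%N ->
  (forall t, 0 <= c t) -> (forall t, c t <= c t.+1) ->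
  (forall t, (0 < t)%N -> 0 <= D t <= B) ->
  \sum_(a <= t < T.+1) c t * (D t - D t.+1) <= c T * B.
Proof.
move=> a0 c0 cS DB.
(* Keeping the last boundary term makes the induction go through: the step uses
   [(c T.+1 - c T) * (B - D T.+1) >= 0]. *)
suff : \sum_(a <= t < T.+1) c t * (D t - D t.+1) <= c T * (B - D T.+1).
  have /andP[D0 _] := DB T.+1 isT; have := mulr_ge0 (c0 T) D0; lra.
elim: T => [|T IH].
  rewrite big_geq // mulr_ge0 // subr_ge0; by have /andP[] := DB 1%N isT.
have /andP[_ DB1] := DB T.+1 isT; have /andP[_ DB2] := DB T.+2 isT.
have [aT|Ta] := leqP a T.+1; last by rewrite big_geq // mulr_ge0 // subr_ge0.
rewrite big_nat_recr //=; have := cS T; nra.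
Qed.

(** The tangent bound for the square root; it isolates the cost of a delay in the stepsize. *)
Lemma sqrt_shift_le (t k m : nat) : (0 < t)%N -> (k <= 2 * m)%N ->
  Num.sqrt (t + k)%:R <= Num.sqrt t%:R + m%:R / Num.sqrt t%:R :> R.
Proof.
move=> t0 km.
have s0 : 0 < Num.sqrt t%:R :> R by rewrite sqrtr_gt0 ltr0n.
have b0 : 0 <= Num.sqrt t%:R + m%:R / Num.sqrt t%:R :> R.
  by rewrite addr_ge0 // ?divr_ge0 // ltW.
rewrite -[leRHS]ger0_norm // -sqrtr_sqr ler_sqrt ?sqr_ge0 //.
rewrite sqrrD sqr_sqrtr //.
have -> : Num.sqrt t%:R * (m%:R / Num.sqrt t%:R) = m%:R :> R.
  by rewrite mulrCA mulfV ?mulr1 ?gt_eqF.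
have : (k%:R : R) <= (2 * m)%:R by rewrite ler_nat.
rewrite natrM natrD => h; have := sqr_ge0 (m%:R / Num.sqrt t%:R : R); lra.
Qed.

(* The two alternatives are the regimes [L * q <= beta^-1] and its opposite;
   in the second one the quadratic bound on the Bregman term is too large. *)
Lemma regime_bound (L G sg q b beta : R) : 0 < L -> 0 < q -> 0 < b -> b <= beta ->
  let S := 192 * (q ^+ 2 * b ^+ 2 * G ^+ 2) + 48 * (q * b ^+ 2 * sg ^+ 2) in
  (L * q * b <= 1 -> L * S <= 193 * (L * q ^+ 2 * G ^+ 2 * beta ^+ 2)
    + 48 * (sg ^+ 2 * beta)) /\
  (1 <= L * q * beta -> b * q * G ^+ 2 + (b * q)^-1 * S <=
     193 * (L * q ^+ 2 * G ^+ 2 * beta ^+ 2) + 48 * (sg ^+ 2 * beta)).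
Proof.
move=> L0 q0 b0 bbeta S.
have sg0 : 0 <= sg ^+ 2 := sqr_ge0 _.
have G0 : 0 <= G ^+ 2 := sqr_ge0 _.
have beta0 : 0 < beta by exact: lt_le_trans bbeta.
have e1 : sg ^+ 2 * b <= sg ^+ 2 * beta by rewrite ler_wpM2l.
split=> H.
- have e0 : 0 <= L * q ^+ 2 * G ^+ 2.
    exact: mulr_ge0 (mulr_ge0 (ltW L0) (sqr_ge0 _)) G0.
  have e2 : L * q ^+ 2 * G ^+ 2 * b ^+ 2 <= L * q ^+ 2 * G ^+ 2 * beta ^+ 2.
    by apply: ler_wpM2l => //; rewrite lerXn2r // nnegrE ltW.
  have e3 : L * q * b * (sg ^+ 2 * b) <= 1 * (sg ^+ 2 * b).
    by apply: ler_wpM2r => //; exact: mulr_ge0 sg0 (ltW b0).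
  have e4 := mulr_ge0 e0 (sqr_ge0 beta).
  have -> : L * S = 192 * (L * q ^+ 2 * G ^+ 2 * b ^+ 2)
    + 48 * (L * q * b * (sg ^+ 2 * b)) by rewrite /S; ring.
  lra.
(* The weight [b * q] turns [S] into [192 * (b * q * G ^+ 2)] plus a noise term of first order in
   [b]; the remaining summand makes 193. *)
- have -> : b * q * G ^+ 2 + (b * q)^-1 * S =
      193 * (b * q * G ^+ 2) + 48 * (sg ^+ 2 * b).
    by rewrite /S; field; rewrite !gt_eqF.
  have qG : 0 <= q * G ^+ 2 := mulr_ge0 (ltW q0) G0.
  have e2 : b * (q * G ^+ 2) <= beta * (q * G ^+ 2).
    exact: ler_wpM2r.
  have e3 : 1 * (beta * (q * G ^+ 2)) <= L * q * beta * (beta * (q * G ^+ 2)).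
    by apply: ler_wpM2r => //; exact: mulr_ge0 (ltW beta0) qG.
  have -> : L * q ^+ 2 * G ^+ 2 * beta ^+ 2 = L * q * beta * (beta * (q * G ^+ 2)).
    by ring.
  rewrite -mulrA; lra.
Qed.

(** Beyond [4 * m], a window reaching back [2 * m] stays above [t / 2], so [t <= 4 * (s + k)]. This
    is the reason for setting the first [4 * m] steps apart. *)
Lemma step_window (L c : R) (t s k m : nat) : 0 < L -> 0 < c ->
  (4 * m < t)%N -> (t - 2 * m <= s)%N ->
  alpha L c s k <= 2 * alpha L c t 0%N.
Proof.
move=> L0 c0 mt ts; rewrite /alpha /Defs.eta addn0.
have s0 : 0 <= Num.sqrt t%:R :> R := sqrtr_ge0 _.
have h : Num.sqrt t%:R <= 2 * Num.sqrt (s + k)%:R :> R.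
  have -> : 2 * Num.sqrt (s + k)%:R = Num.sqrt (4 * (s + k)%:R) :> R.
    rewrite sqrtrM // -[4](_ : 2 ^+ 2 = _) ?sqrtr_sqr ?ger0_norm //.
    by rewrite expr2 -natrM.
  rewrite ler_sqrt ?mulr_ge0 // -natrM ler_nat; lia.
have k0 : 0 <= Num.sqrt (s + k)%:R :> R := sqrtr_ge0 _.
have p1 : 0 < L + c * Num.sqrt t%:R by rewrite ltr_pwDl // mulr_ge0 // ltW.
have p2 : 0 < L + c * Num.sqrt (s + k)%:R by rewrite ltr_pwDl // mulr_ge0 // ltW.
rewrite -(ler_pM2l p2) mulfV ?gt_eqF // mulrCA mulrA ler_pdivlMr // mul1r.
have := ler_wpM2l (ltW c0) h; lra.
Qed.

(** The logarithmic term dictates 300: [D2] is at least [2 / 3] of [L * m ^+ 2 * G ^+ 2 / c ^+ 2],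
    and 193 times [3 / 2] is below 300. The other terms need at most 98. *)
Lemma rate_bound (L c sigma r G : R) (m T : nat) :
  0 < L -> 0 <= r -> 0 <= G -> 0 < c -> (0 < m)%N -> (0 < T)%N ->
  T%:R^-1 * (4 * m%:R * (G * r) + (2^-1 * (L + c * Num.sqrt T%:R) * r ^+ 2
     + c * m%:R * r ^+ 2 * Num.sqrt T%:R)
     + (193 * (L * m%:R ^+ 2 * G ^+ 2 / c ^+ 2) * ln T%:R
     + 98 * (sigma ^+ 2 / c) * Num.sqrt T%:R))
  <= 300 * (D1 c sigma r m * (Num.sqrt T%:R / T%:R)
            + D2 L c G m * (ln T%:R / T%:R) + D3 L c r G m * (1 / T%:R)).
Proof.
move=> L0 r0 G0 c0 m0 T0.
have T1 : 1 <= T%:R :> R by rewrite ler1n.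
have -> : 300 * (D1 c sigma r m * (Num.sqrt T%:R / T%:R)
            + D2 L c G m * (ln T%:R / T%:R) + D3 L c r G m * (1 / T%:R)) =
  T%:R^-1 * (300 * (D1 c sigma r m * Num.sqrt T%:R + D2 L c G m * ln T%:R
    + D3 L c r G m)) by ring.
apply: ler_wpM2l; first by rewrite invr_ge0 ler0n.
have q1 : 1 <= m%:R :> R by rewrite ler1n.
have s0 : 0 <= Num.sqrt T%:R :> R := sqrtr_ge0 _.
have l0 : 0 <= ln T%:R :> R by rewrite ln_ge0.
have s2 : 1 <= Num.sqrt 2 :> R by rewrite -[leLHS]sqrtr1 ler_wsqrtr // ler1n.
have rr := sqr_ge0 r; have GG := sqr_ge0 G.
have sc : 0 <= sigma ^+ 2 / c by rewrite divr_ge0 ?sqr_ge0 // ltW.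
have cr : 0 <= c * r ^+ 2 by rewrite mulr_ge0 // ltW.
have d1 : c * r ^+ 2 * m%:R + sigma ^+ 2 / c <= D1 c sigma r m.
  rewrite /D1 lerD2r; have cq := mulr_ge0 cr (ltW (lt_le_trans ltr01 q1)).
  have := ler_wpM2r cq s2; lra.
set k := L * m%:R ^+ 2 * G ^+ 2 / c ^+ 2.
have k0 : 0 <= k.
  apply: mulr_ge0; last by rewrite invr_ge0 sqr_ge0.
  exact: mulr_ge0 (mulr_ge0 (ltW L0) (sqr_ge0 _)) GG.
have d2 : 2 / 3 * k <= D2 L c G m.
  have u0 : 0 <= L * G ^+ 2 / c ^+ 2.
    by apply: mulr_ge0; [exact: mulr_ge0 (ltW L0) GG|rewrite invr_ge0 sqr_ge0].
  have -> : D2 L c G m = L * G ^+ 2 / c ^+ 2 * ((4 * m%:R + 3) * (m%:R + 1) / 6).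
    by rewrite /D2; field; rewrite gt_eqF.
  have -> : 2 / 3 * k = L * G ^+ 2 / c ^+ 2 * (2 / 3 * m%:R ^+ 2).
    by rewrite /k; field; rewrite gt_eqF.
  by apply: ler_wpM2l => //; nra.
have d3 : 2^-1 * (L + c) * r ^+ 2 + m%:R * G * r <= D3 L c r G m.
  rewrite /D3 lerDl; apply: divr_ge0.
    rewrite !(mulr_ge0 _ (sqr_ge0 _)) // ?mulr_ge0 ?addr_ge0 ?(ltW L0) //.
  by rewrite mulr_ge0 // addr_ge0 // sqr_ge0.
have a1 := ler_wpM2r s0 d1; have a2 := ler_wpM2r l0 d2.
have b1 := mulr_ge0 cr s0.
have b2 := ler_wpM2l b1 q1.
have b3 : 0 <= m%:R * G * r by rewrite !mulr_ge0.
have b4 := mulr_ge0 sc s0; have b5 := mulr_ge0 k0 l0.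
have b6 : 0 <= L * r ^+ 2 := mulr_ge0 (ltW L0) rr.
move: (Num.sqrt T%:R) (ln T%:R) (sigma ^+ 2 / c) a1 a2 b1 b2 b4 b5 => S l e *.
lra.
Qed.

End sums.

(** * Calculus of upper bounds in expectation *)

Section mean_bounds.
Context {R : realType} {dT : measure_display} {T : measurableType dT}
  {P : probability T R}.
Implicit Types (h k : T -> R) (a b : R).

(** Integrability travels with the bound, so that sums and nonnegative multiples compose without
    side conditions. *)
Definition mean_le h a :=
  P.-integrable setT (EFin \o h) /\ (\int[P]_w (h w)%:E <= a%:E)%E.

Lemma mean_le_trans h a b : a <= b -> mean_le h a -> mean_le h b.
Proof. by move=> ab [ih ha]; split=> //; apply: le_trans ha _; rewrite lee_fin. Qed.

Lemma mean_le_cst a : mean_le (fun=> a) a.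
Proof.
split; last by rewrite integral_probability_cst.
exact: finite_measure_integrable_cst.
Qed.

Lemma mean_leD h k a b : mean_le h a -> mean_le k b ->
  mean_le (fun w => h w + k w) (a + b).
Proof.
move=> [ih ha] [ik kb]; split; first exact: (integrableD measurableT ih ik).
have -> : (\int[P]_w (h w + k w)%:E = \int[P]_w (h w)%:E + \int[P]_w (k w)%:E)%E.
  by rewrite -(integralD measurableT ih ik); apply: eq_integral => w _.
by rewrite EFinD leeD.
Qed.

Lemma mean_leZ h a b : 0 <= b -> mean_le h a -> mean_le (fun w => b * h w) (b * a).
Proof.
move=> b0 [ih ha]; split; first exact: (integrableZl measurableT b ih).
have -> : (\int[P]_w (b * h w)%:E = b%:E * \int[P]_w (h w)%:E)%E.
  by rewrite -(integralZl measurableT ih); apply: eq_integral => w _.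
by rewrite EFinM lee_wpmul2l // lee_fin.
Qed.

Lemma mean_le_sum (h : nat -> T -> R) (a : nat -> R) (m n : nat) :
  (forall t, (m <= t < n)%N -> mean_le (h t) (a t)) ->
  mean_le (fun w => \sum_(m <= t < n) h t w) (\sum_(m <= t < n) a t).
Proof.
elim: n => [|n IH] H.
  rewrite big_geq //; under [fun w => _]funext do rewrite big_geq //.
  exact: mean_le_cst.
have [mn|nm] := leqP m n; last first.
  rewrite big_geq //; under [fun w => _]funext do rewrite big_geq //.
  exact: mean_le_cst.
rewrite big_nat_recr //=; under [fun w => _]funext do rewrite big_nat_recr //=.
apply: mean_leD; last by apply: H; rewrite mn ltnSn.
by apply: IH => t /andP[mt tn]; apply: H; rewrite mt ltnW.
Qed.

(** The exceptional set is there because the delays stay within the uniform range only almost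
    surely. *)
Lemma mean_le_ae (N : set T) h k a : measurable N -> P N = 0%E ->
  measurable_fun setT h -> (forall w, 0 <= h w) ->
  (exists B, forall w, h w <= B) ->
  (forall w, ~ N w -> h w <= k w) -> mean_le k a -> mean_le h a.
Proof.
move=> mN PN mh h0 [B hB] hk [ik ka].
have ih : P.-integrable setT (EFin \o h).
  have ic : P.-integrable setT (EFin \o (fun=> B)).
    exact: finite_measure_integrable_cst.
  apply: le_integrable ic => //; first exact/measurable_EFinP.
  by move=> w _ /=; rewrite lee_fin ger0_norm // (le_trans (hB w)) // ler_norm.
split=> //; apply: le_trans ka.
rewrite (negligible_integral mN measurableT ih PN).
rewrite (negligible_integral mN measurableT ik PN).
have mD : measurable (setT `\` N) by exact: measurableD.
apply: le_integral => //.
- exact: (integrableS measurableT mD (@subsetT _ _) ih).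
- exact: (integrableS measurableT mD (@subsetT _ _) ik).
- by move=> w; rewrite inE => -[_ Nw]; rewrite lee_fin; exact: hk.
Qed.

Lemma mean_le_dom h k a : measurable_fun setT h -> (forall w, 0 <= h w) ->
  (forall w, h w <= k w) -> (exists B, forall w, h w <= B) ->
  mean_le k a -> mean_le h a.
Proof.
move=> mh h0 hk hB; exact: (@mean_le_ae set0).
Qed.

End mean_bounds.

(** * The delayed iteration *)

Section oracle_noise.
Context {R : realType} {d : nat} {d0 dX : measure_display}
  {Omega : measurableType d0} {P : probability Omega R}
  {Xi : measurableType dX} {Q : probability Xi R}.
Variables (X : set 'rV[R]_d) (F : 'rV[R]_d -> Xi -> R) (f : 'rV[R]_d -> R)
  (L sigma : R) (step : nat -> nat -> R) (x1 : 'rV[R]_d)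
  (xi : nat -> {RV P >-> Xi}) (tau : nat -> {RV P >-> nat})
  (x : nat -> Omega -> 'rV[R]_d).
Hypothesis L0 : 0 < L.
Hypothesis sigma0 : 0 <= sigma.
Hypothesis step0 : forall t k, (0 < t)%N -> 0 < step t k.
Hypothesis compX : compact X.
Hypothesis convX : convex_set X.
Hypothesis measF :
  measurable_fun (X `*` setT : set (borel_rV R d * Xi))
    (fun z : borel_rV R d * Xi => grad (F^~ z.2) z.1 : borel_rV R d).
Hypothesis lipf : forall y z, X y -> X z ->
  enorm (grad f y - grad f z) <= L * enorm (y - z).
Hypothesis varF : forall y, X y ->
  ('E_Q[fun s => (enorm (grad f y - grad (F^~ s) y) ^+ 2)%R] <= (sigma ^+ 2)%:E)%E.
Hypothesis unbF : forall y, X y -> forall i : 'I_d,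
  ('E_Q[fun s => grad (F^~ s) y ord0 i] = (grad f y ord0 i)%:E)%E.
Hypothesis lawxi : forall t, (0 < t)%N -> forall A, measurable A ->
  distribution P (xi t) A = Q A.
Hypothesis indep : mutually_independent P positive_time (sample_delay_sigma xi tau).
Hypothesis tau_lt : forall t w, (0 < t)%N -> (tau t w <= t.-1)%N.
Hypothesis Xx1 : X x1.
Hypothesis sgd : delayed_sgd X F step x1 xi tau x.

Definition delayed (t : nat) (w : Omega) := x (t - tau t w)%N w.

Definition noise (t : nat) (w : Omega) :=
  grad f (delayed t w) - grad (F^~ (xi t w)) (delayed t w).

Lemma iterate_in t w : (0 < t)%N -> X (x t w).
Proof.
case: t => // -[|t] _; first by rewrite sgd.1.
by have [] := sgd.2 t.+1 w isT.
Qed.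

Lemma delayed_gt0 t w : (0 < t)%N -> (0 < t - tau t w)%N.
Proof. by case: t => // t _; rewrite subn_gt0 ltnS; exact: tau_lt. Qed.

Lemma delayed_in t w : (0 < t)%N -> X (delayed t w).
Proof. by move=> t0; apply: iterate_in; exact: delayed_gt0. Qed.

Lemma measurable_X : measurable (X : set (borel_rV R d)).
Proof.
rewrite -[X]setCK; apply: measurableC; apply: sub_sigma_algebra.
rewrite /= openC; apply: compact_closed compX; exact: norm_hausdorff.
Qed.

Lemma measurable_oracle dT (T : measurableType dT) (z : T -> 'rV[R]_d) (s : T -> Xi) :
  (forall w, X (z w)) -> measurable_fun setT (z : T -> borel_rV R d) ->
  measurable_fun setT s ->
  measurable_fun setT ((fun w => grad (F^~ (s w)) (z w)) : T -> borel_rV R d).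
Proof.
move=> Xz mz ms.
apply: (@measurable_comp _ _ _ T (borel_rV R d * Xi)%type (borel_rV R d) (X `*` setT)
  (fun z : borel_rV R d * Xi => grad (F^~ z.2) z.1 : borel_rV R d) setT
  (fun w => (z w : borel_rV R d, s w))).
- by apply: measurableX => //; exact: measurable_X.
- by move=> _ [w _ <-]; split=> //=.
- exact: measF.
- exact: measurable_fun_pair.
Qed.

(** On [X] the gradient of [f] is Lipschitz, which already makes it Borel along [z]. *)
Lemma measurable_grad dT (T : measurableType dT) (z : T -> 'rV[R]_d) :
  (forall w, X (z w)) -> measurable_fun setT (z : T -> borel_rV R d) ->
  measurable_fun setT ((fun w => grad f (z w)) : T -> borel_rV R d).
Proof.
move=> Xz; apply: measurable_lipschitz_factor L0 _ => w w'; exact: lipf.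
Qed.

Lemma filt_delayed_aux t : (0 < t)%N ->
  (forall s, (0 < s <= t)%N ->
    measurable_fun setT (x s : filt xi tau t -> borel_rV R d)) ->
  measurable_fun setT (delayed t : filt xi tau t -> borel_rV R d).
Proof.
move=> t0 mx.
(* For [j >= t] the index [t - j] would be 0, where the iterate is unconstrained; [x t] is a dummy
   never reached. *)
pose h j : filt xi tau t -> borel_rV R d := if (j < t)%N then x (t - j)%N else x t.
have -> : delayed t = (fun w => h (tau t w) w).
  apply/funext => w; rewrite /h ifT //.
  by case: (t) t0 => // t' _; rewrite ltnS; exact: (tau_lt w (ltn0Sn t')).
apply: measurable_switch; first exact: filt_tau.
move=> j; rewrite /h; case: ifPn => jt; apply: mx; last by rewrite t0 leqnn.
by rewrite subn_gt0 jt leq_subr.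
Qed.

(** The new iterate is a 1-Lipschitz function of [x t - a *: g], which is known at the next time.
    Strong induction, since the oracle may be called at any earlier iterate. *)
Lemma filt_iterate t : (0 < t)%N ->
  measurable_fun setT (x t : filt xi tau t -> borel_rV R d).
Proof.
elim/ltn_ind: t => -[//|[_ _|t IH _]].
  rewrite (_ : x 1%N = fun=> x1); first exact: measurable_cst.
  by apply/funext => w; exact: sgd.1.
have mx s : (0 < s <= t.+1)%N ->
    measurable_fun setT (x s : filt xi tau t.+1 -> borel_rV R d).
  by move=> /andP[s0 st]; exact: (filt_le st (IH s st s0)).
have mz := filt_le (leqnSn _) (filt_delayed_aux (ltn0Sn t) mx).
pose a (w : filt xi tau t.+2) := step t.+1 (tau t.+1 w).
have ma : measurable_fun setT a.
  have ms : measurable_fun setT (step t.+1) by [].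
  by apply: (measurableT_comp ms); exact: filt_tau.
pose g (w : filt xi tau t.+2) := grad (F^~ (xi t.+1 w)) (delayed t.+1 w).
have mg : measurable_fun setT (g : _ -> borel_rV R d).
  apply: measurable_oracle => //; last by apply: filt_xi; rewrite /= ltnSn.
  by move=> w; exact: delayed_in.
apply: (@measurable_lipschitz_factor _ _ _ d d
  (fun w : filt xi tau t.+2 => x t.+1 w - a w *: g w) _ 1) => //.
  move=> w w'; rewrite mul1r.
  have := sgd.2 t.+1 w isT; have := sgd.2 t.+1 w' isT => /= h' h.
  by apply: (prox_nonexpansive convX _ h _ h'); exact: step0.
apply: measurable_subv; last exact: measurable_scalev.
exact: (filt_le (leqnSn _) (IH _ (ltnSn _) isT)).
Qed.

Lemma filt_iterate_le s t : (0 < s <= t)%N ->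
  measurable_fun setT (x s : filt xi tau t -> borel_rV R d).
Proof. by move=> /andP[s0 st]; exact: filt_le st (filt_iterate s0). Qed.

Lemma filt_delayed t : (0 < t)%N ->
  measurable_fun setT (delayed t : filt xi tau t -> borel_rV R d).
Proof. by move=> t0; apply: filt_delayed_aux => // s; exact: filt_iterate_le. Qed.

Lemma measurable_noise t : (0 < t)%N ->
  measurable_fun setT (noise t : Omega -> borel_rV R d).
Proof.
move=> t0; have mz := filt_measurable (filt_delayed t0).
apply: measurable_subv.
  by apply: measurable_grad => // w; exact: delayed_in.
by apply: measurable_oracle => // w; exact: delayed_in.
Qed.

(** The noise with its two sources separated: the past [z.1] and the fresh sample [z.2]. *)
Let N t (z : filt xi tau t * Xi) :=
  grad f (delayed t z.1) - grad (F^~ z.2) (delayed t z.1).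

Let mN t : (0 < t)%N -> measurable_fun setT (@N t : _ -> borel_rV R d).
Proof.
move=> t0.
have mz : measurable_fun setT
    ((fun z : filt xi tau t * Xi => delayed t z.1) : _ -> borel_rV R d).
  exact: (measurableT_comp (filt_delayed t0) measurable_fst).
apply: measurable_subv.
  by apply: measurable_grad => // w; exact: delayed_in.
by apply: measurable_oracle => // w; exact: delayed_in.
Qed.

Let history_measurable t : measurable_fun setT (id : Omega -> filt xi tau t).
Proof. by move=> _ A mA; rewrite setTI; exact: past_le_measurable mA. Qed.

(** The whole past as one random variable, independent of the sample [xi t]. *)
Let history t : {RV P >-> filt xi tau t} :=
  HB.pack_for {mfun Omega >-> filt xi tau t} (id : Omega -> filt xi tau t)
    (isMeasurableFun.Build _ _ _ _ (id : Omega -> filt xi tau t)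
       (@history_measurable t)).

Let history_indep t A B : (0 < t)%N -> measurable A -> measurable B ->
  (P (history t @^-1` A `&` xi t @^-1` B) =
   P (history t @^-1` A) * P (xi t @^-1` B))%E.
Proof. by move=> t0 mA mB; exact: (past_indep indep t0 mA mB). Qed.

Lemma noise_variance t : (0 < t)%N ->
  (\int[P]_w (dot (noise t w) (noise t w))%:E <= (sigma ^+ 2)%:E)%E.
Proof.
move=> t0.
apply: (indep_ge0_integral_le (lawxi t0) (fun A B => @history_indep t A B t0)
  (f := fun z => (dot (@N t z) (@N t z))%:E)).
- apply/measurable_EFinP.
  exact: (measurable_dot (mN t0) (mN t0)).
- by move=> z; rewrite lee_fin dotvv_ge0.
- move=> w; have := varF (delayed_in w t0); rewrite unlock.
  by under eq_integral do rewrite enorm_sqr.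
Qed.

Lemma noise_sqr_integrable t : (0 < t)%N ->
  P.-integrable setT (fun w => (dot (noise t w) (noise t w))%:E).
Proof.
move=> t0; apply/integrableP; split.
  apply/measurable_EFinP.
  exact: (measurable_dot (measurable_noise t0) (measurable_noise t0)).
under eq_integral do rewrite gee0_abs ?lee_fin ?dotvv_ge0 //.
by apply: le_lt_trans (noise_variance t0) _; rewrite ltry.
Qed.

Lemma dot_delta (u : 'rV[R]_d) i : dot u (delta_mx 0 i) = u 0 i.
Proof.
rewrite dotE (bigD1 i) //= mxE !eqxx mulr1 big1 ?addr0 // => j ji.
by rewrite mxE (negbTE ji) andbF mulr0.
Qed.

Lemma dot_abs_le (u v : 'rV[R]_d) : `|dot u v| <= dot u u + dot v v.
Proof.
have h1 := dot_young u v ltr01; have h2 := dot_young (- u) v ltr01.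
have := dotvv_ge0 u; have := dotvv_ge0 v.
move: h1 h2; rewrite !dot_bilin invr1 opprK !mul1r => *.
by rewrite ler_norml; apply/andP; split; lra.
Qed.

Lemma integrable_dot dT (T : measurableType dT) (mu : probability T R)
    (h k : T -> 'rV[R]_d) (K : R) :
  measurable_fun setT (h : T -> borel_rV R d) ->
  measurable_fun setT (k : T -> borel_rV R d) ->
  mu.-integrable setT (fun w => (dot (h w) (h w))%:E) ->
  (forall w, dot (k w) (k w) <= K) ->
  mu.-integrable setT (fun w => (dot (h w) (k w))%:E).
Proof.
move=> mh mk ih kK.
have ik : mu.-integrable setT (fun w => (dot (h w) (h w) + K)%:E).
  under eq_fun do rewrite EFinD; apply: integrableD => //.
  exact: finite_measure_integrable_cst.
apply: le_integrable ik => //.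
  apply/measurable_EFinP; exact: (measurable_dot mh mk).
move=> w _; rewrite /= lee_fin.
apply: le_trans (dot_abs_le _ _) _; apply: le_trans (ler_norm _).
by rewrite lerD2l.
Qed.

Lemma noise_cross_integrable t (v : Omega -> 'rV[R]_d) (K : R) : (0 < t)%N ->
  measurable_fun setT (v : filt xi tau t -> borel_rV R d) ->
  (forall w, dot (v w) (v w) <= K) ->
  P.-integrable setT (fun w => (dot (noise t w) (v w))%:E).
Proof.
move=> t0 mv vK.
exact: (integrable_dot (measurable_noise t0) (filt_measurable mv)
  (noise_sqr_integrable t0) vK).
Qed.

(** Freezing the past makes [v] a constant, and unbiasedness applies coordinate by coordinate. [v]
    may contain the random stepsize, as delays belong to the past. *)
Lemma noise_cross t (v : Omega -> 'rV[R]_d) (K : R) : (0 < t)%N ->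
  measurable_fun setT (v : filt xi tau t -> borel_rV R d) ->
  (forall w, dot (v w) (v w) <= K) ->
  (\int[P]_w (dot (noise t w) (v w))%:E = 0)%E.
Proof.
move=> t0 mv vK.
have mo y : X y -> measurable_fun setT ((fun s => grad (F^~ s) y) : Xi -> borel_rV R d).
  by move=> Xy; apply: measurable_oracle.
have mNy y : X y ->
    measurable_fun setT ((fun s => grad f y - grad (F^~ s) y) : Xi -> borel_rV R d).
  by move=> Xy; apply: measurable_subv => //; exact: mo.
have iN y : X y -> Q.-integrable setT (fun s =>
    (dot (grad f y - grad (F^~ s) y) (grad f y - grad (F^~ s) y))%:E).
  move=> Xy; apply/integrableP; split.
    apply/measurable_EFinP; exact: (measurable_dot (mNy _ Xy) (mNy _ Xy)).
  under eq_integral do rewrite gee0_abs ?lee_fin ?dotvv_ge0 // -enorm_sqr.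
  by have := varF Xy; rewrite unlock => /le_lt_trans; apply; rewrite ltry.
have iNv y u : X y -> Q.-integrable setT (fun s =>
    (dot (grad f y - grad (F^~ s) y) u)%:E).
  move=> Xy; apply: (integrable_dot (K := dot u u) (mNy _ Xy) _ (iN _ Xy)) => //.
apply: (indep_integral0 (lawxi t0) (fun A B => @history_indep t A B t0)
  (f := fun z => dot (@N t z) (v z.1))).
- apply: (measurable_dot (mN t0)).
  exact: (measurableT_comp mv measurable_fst).
- exact: noise_cross_integrable vK.
- by move=> w; exact: (iNv (delayed t w) (v w) (delayed_in w t0)).
move=> w /=; have := delayed_in w t0; rewrite /N /=.
move: (delayed t w) (v w) => y u Xy.
have ic i : Q.-integrable setT (fun s => ((grad f y - grad (F^~ s) y) 0 i)%:E).
  by have := iNv y (delta_mx 0 i) Xy; under eq_fun do rewrite dot_delta.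
(* Unbiasedness is stated for integrals only; integrability of the oracle is recovered from its
   finite variance. *)
have ig i : Q.-integrable setT (fun s => (grad (F^~ s) y 0 i)%:E).
  have -> : (fun s => (grad (F^~ s) y 0 i)%:E) =
      (fun s => (grad f y 0 i)%:E - ((grad f y - grad (F^~ s) y) 0 i)%:E)%E.
    by apply/funext => s; rewrite -EFinB; congr EFin; rewrite !mxE; lra.
  by apply: integrableB => //; exact: finite_measure_integrable_cst.
have i0 i : (\int[Q]_s ((grad f y - grad (F^~ s) y) 0 i)%:E = 0)%E.
  have -> : (\int[Q]_s ((grad f y - grad (F^~ s) y) 0 i)%:E =
      \int[Q]_s ((grad f y 0 i)%:E - (grad (F^~ s) y 0 i)%:E))%E.
    by apply: eq_integral => s _; rewrite -EFinB; congr EFin; rewrite !mxE.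
  rewrite integralB //; last exact: finite_measure_integrable_cst.
  rewrite integral_probability_cst.
  by have := unbF Xy i; rewrite unlock => ->; rewrite subee.
under eq_integral do rewrite dotE -sumEFin.
rewrite integral_sum //; last first.
  by move=> i; under eq_fun do rewrite EFinM; exact: integrableZr.
apply: big1 => i _; under eq_integral do rewrite EFinM.
by rewrite integralZr // i0 mul0e.
Qed.

Lemma mean_le_noise_sqr t : (0 < t)%N ->
  mean_le (P := P) (fun w => dot (noise t w) (noise t w)) (sigma ^+ 2).
Proof. by move=> t0; split; [exact: noise_sqr_integrable|exact: noise_variance]. Qed.

Lemma mean_le_noise_cross t (v : Omega -> 'rV[R]_d) (K : R) : (0 < t)%N ->
  measurable_fun setT (v : filt xi tau t -> borel_rV R d) ->
  (forall w, dot (v w) (v w) <= K) ->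
  mean_le (P := P) (fun w => dot (noise t w) (v w)) 0.
Proof.
move=> t0 mv vK; split; first exact: noise_cross_integrable vK.
by rewrite (noise_cross t0 mv vK).
Qed.

(** * Drift of the iterates away from the delayed point *)

Variables (G r : R) (m : nat) (xstar : 'rV[R]_d).
Hypothesis G0 : 0 <= G.
Hypothesis r0 : 0 <= r.
Hypothesis convf : conv_on X f.
Hypothesis diff_f : forall y, X y -> differentiable f y.
Hypothesis Xxstar : X xstar.
Hypothesis distX : forall y, X y -> enorm (y - xstar) <= r.
Hypothesis gradX : forall y, X y -> enorm (grad f y) <= G.

Lemma dist_star y : X y -> dot (y - xstar) (y - xstar) <= r ^+ 2.
Proof. by move=> Xy; rewrite -enorm_sqr lerXn2r ?nnegrE ?enorm_ge0 // distX. Qed.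

Lemma dist_le y z : X y -> X z -> dot (y - z) (y - z) <= 4 * r ^+ 2.
Proof.
move=> /dist_star hy /dist_star hz.
have -> : y - z = (y - xstar) - (z - xstar) by rewrite opprB addrA subrK.
have := dotvv_ge0 ((y - xstar) + (z - xstar)); move: hy hz.
move: (y - xstar) (z - xstar) => u v; rewrite !dot_bilin; lra.
Qed.

(* The delay is truncated at [2 * m], which changes nothing almost surely. *)
Definition lag (t : nat) (w : Omega) := minn (tau t w) (2 * m).

(** The delayed point of time [t], stopped at [s]: it equals the current iterate until that point is
    reached and is frozen afterwards. Thus it is known at time [s], and the spread starts from
    zero. *)
Definition anchor (t s : nat) (w : Omega) := x (minn s (t - lag t w)) w.

Lemma anchor_gt0 t s w : (2 * m < t)%N -> (0 < s)%N -> (0 < minn s (t - lag t w))%N.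
Proof. by rewrite /lag; lia. Qed.

Lemma filt_anchor t s : (2 * m < t)%N -> (0 < s)%N ->
  measurable_fun setT (anchor t s : filt xi tau s -> borel_rV R d).
Proof.
move=> mt s0.
apply: (@measurable_switch _ _ _ (borel_rV R d) (tau t : filt xi tau s -> nat)
  (fun j => x (minn s (t - minn j (2 * m))) : filt xi tau s -> borel_rV R d)).
  by apply: filt_tau; lia.
by move=> j; apply: filt_iterate_le; lia.
Qed.

Definition spread (t s : nat) (w : Omega) :=
  dot (x s w - anchor t s w) (x s w - anchor t s w).

Lemma measurable_spread t s : (2 * m < t)%N -> (0 < s)%N ->
  measurable_fun setT (spread t s).
Proof.
move=> mt s0; apply: (filt_measurable (xi := xi) (tau := tau) (t := s)).
have mv : measurable_fun setT
    ((fun w => x s w - anchor t s w) : filt xi tau s -> borel_rV R d).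
  by apply: measurable_subv; [exact: filt_iterate|exact: filt_anchor].
exact: (measurable_dot mv mv).
Qed.

(** The summand [2 * 0] is the mean of the noise cross term. *)
Lemma mean_spread_step t s (A a : R) : (2 * m < t)%N -> (0 < s)%N ->
  (forall k, step s k <= A) -> let M : R := (2 * m + 1)%:R in
  mean_le (P := P) (spread t s) a ->
  mean_le (P := P) (spread t s.+1) ((1 + (2 * M)^-1) * a + 2 * 0
    + A ^+ 2 * (2 * M + 2) * G ^+ 2 + 2 * A ^+ 2 * sigma ^+ 2).
Proof.
move=> mt s0 sA M Va.
have M0 : 0 < M by rewrite ltr0n addn1.
have A0 : 0 < A by apply: lt_le_trans (sA 0%N); exact: step0.
have sqA k : step s k ^+ 2 <= A ^+ 2.
  by rewrite lerXn2r ?nnegrE // ?ltW // step0.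
have Xa w : X (anchor t s w) by apply: iterate_in; exact: anchor_gt0.
(* The random stepsize is moved into the vector, which keeps it measurable with respect to the
   past. *)
pose v (w : Omega) := step s (tau s w) *: (x s w - anchor t s w).
have mv : measurable_fun setT (v : filt xi tau s -> borel_rV R d).
  apply: measurable_scalev; last first.
    by apply: measurable_subv; [exact: filt_iterate|exact: filt_anchor].
  have ms : measurable_fun setT (step s) by [].
  by apply: (measurableT_comp ms); exact: filt_tau.
have vK w : dot (v w) (v w) <= A ^+ 2 * (4 * r ^+ 2).
  rewrite /v dotZl dotZr mulrA -expr2 ler_pM ?sqr_ge0 ?dotvv_ge0 //.
  by apply: dist_le => //; exact: iterate_in.
apply: (@mean_le_dom _ _ _ _ _ (fun w => (1 + (2 * M)^-1) * spread t s w
  + 2 * dot (noise s w) (v w) + A ^+ 2 * (2 * M + 2) * G ^+ 2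
  + 2 * A ^+ 2 * dot (noise s w) (noise s w))).
- exact: measurable_spread.
- by move=> w; exact: dotvv_ge0.
- move=> w.
  have c1 : 0 <= A ^+ 2 * (2 * M + 2) * G ^+ 2.
    by rewrite !mulr_ge0 ?sqr_ge0 //; lra.
  have c2 : 0 <= 2 * A ^+ 2 * dot (noise s w) (noise s w).
    by apply: mulr_ge0; [rewrite mulr_ge0 ?sqr_ge0|exact: dotvv_ge0].
  (* Before the delayed point is reached both spreads vanish; afterwards the anchor no longer moves
     and [prox_drift] applies. *)
  have [ts|st] := leqP (t - lag t w) s; last first.
    have e1 : x s w - anchor t s w = 0.
      by rewrite /anchor (minn_idPl _) ?subrr // ltnW.
    have e2 : x s.+1 w - anchor t s.+1 w = 0.
      by rewrite /anchor (minn_idPl _) ?subrr.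
    rewrite /spread /v; rewrite e1 e2 scaler0 dot0 -[X in dot _ X](scale0r 0) dotZr.
    by rewrite mul0r !mulr0 !add0r addr_ge0.
  have e2 : anchor t s.+1 w = anchor t s w.
    by rewrite /anchor !(minn_idPr _) // ltnW.
  rewrite /spread e2.
  have := prox_drift convX (step0 (tau s w) s0) M0 (sgd.2 s w s0) (Xa w) G0
    (gradX (delayed_in w s0)).
  rewrite -/(noise s w) -/(v w) => /le_trans; apply.
  have c3 : 0 <= (2 * M + 2) * G ^+ 2 by rewrite mulr_ge0 ?sqr_ge0 //; lra.
  have c4 := ler_wpM2r c3 (sqA (tau s w)).
  have c5 := ler_wpM2r (dotvv_ge0 (noise s w)) (sqA (tau s w)).
  rewrite -!mulrA in c4 c5 *; lra.
- exists (4 * r ^+ 2) => w; apply: dist_le; first exact: iterate_in.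
  by apply: iterate_in; exact: anchor_gt0.
apply: mean_leD; first apply: mean_leD; first apply: mean_leD.
- apply: mean_leZ Va; rewrite addr_ge0 // invr_ge0; lra.
- by apply: mean_leZ => //; exact: mean_le_noise_cross vK.
- exact: mean_le_cst.
- apply: mean_leZ; first by rewrite mulr_ge0 ?sqr_ge0.
  exact: mean_le_noise_sqr.
Qed.

(** From [t - 2 * m] to [t.+1] there are [M] steps, each adding [K]. After [k <= M] steps the bound
    [2 * k * K] persists, because the growth factor adds only [k * K / M <= K]. *)
Lemma mean_spread t (A : R) : (2 * m < t)%N ->
  (forall s k, (t - 2 * m <= s <= t)%N -> step s k <= A) ->
  let M : R := (2 * m + 1)%:R in
  mean_le (P := P) (spread t t.+1)
    (2 * M * (A ^+ 2 * (2 * M + 2) * G ^+ 2 + 2 * A ^+ 2 * sigma ^+ 2)).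
Proof.
move=> mt sA M; set K := A ^+ 2 * _ * _ + _.
have M0 : 0 < M by rewrite ltr0n addn1.
have A0 : 0 <= A.
  by apply: le_trans (sA t 0%N _); [apply: ltW; apply: step0; lia|lia].
have K0 : 0 <= K by rewrite /K addr_ge0 // !mulr_ge0 ?sqr_ge0 //; lra.
suff H k : (k <= 2 * m + 1)%N ->
    mean_le (P := P) (spread t (t - 2 * m + k)) (2 * k%:R * K).
  by have := H _ (leqnn _); rewrite (_ : t - 2 * m + (2 * m + 1) = t.+1)%N //; lia.
elim: k => [_|k IH km].
  rewrite addn0 mulr0 mul0r.
  have -> : spread t (t - 2 * m) = fun=> 0.
    apply/funext => w; rewrite /spread /anchor (minn_idPl _) ?subrr ?dot0 //.
    by rewrite /lag; lia.
  exact: mean_le_cst.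
rewrite addnS; apply: mean_le_trans (mean_spread_step (A := A) _ _ _ (IH (ltnW km))) => //.
- have kS : k.+1%:R = k%:R + 1 :> R by rewrite natr1.
  rewrite -/M mulr0 addr0 -addrA -/K kS.
  have kM : k%:R <= M by rewrite ler_nat ltnW.
  have -> : (1 + (2 * M)^-1) * (2 * k%:R * K) = 2 * k%:R * K + k%:R * K / M.
    by field; rewrite gt_eqF.
  have : k%:R * K / M <= K by rewrite ler_pdivrMr // mulrC ler_wpM2l.
  have -> : 2 * (k%:R + 1) * K = 2 * k%:R * K + (K + K) by ring.
  by rewrite -addrA lerD2l lerD2r.
- lia.
- by move=> j; apply: sA; lia.
Qed.

(** * Bregman terms and summation of the optimality gaps *)

Variable c : R.
Hypothesis c0 : 0 < c.
Hypothesis m0 : (0 < m)%N.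
Hypothesis stepE : step = alpha L c.

Let beta (t : nat) : R := (c * Num.sqrt t%:R)^-1.
Let b (t : nat) : R := alpha L c t 0%N.

Let b_gt0 t : 0 < b t.
Proof. by rewrite invr_gt0 ltr_pwDl // mulr_ge0 // ltW. Qed.

Let sqrt_gt0 t : (0 < t)%N -> 0 < Num.sqrt t%:R :> R.
Proof. by move=> t0; rewrite sqrtr_gt0 ltr0n. Qed.

Let b_le t : (0 < t)%N -> b t <= beta t.
Proof.
move=> t0; rewrite /b /beta /alpha /Defs.eta addn0 lef_pV2 ?posrE.
- by rewrite lerDr ltW.
- by rewrite ltr_pwDl // mulr_ge0 // ltW.
- by rewrite mulr_gt0 // sqrt_gt0.
Qed.

(** In the second branch [2 * G * |z - y|] is split by Young with weight [b t * m], so that both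
    branches are affine in the squared distance, whose mean is known. The test depends on [t] only,
    not on the outcome. *)
Definition bregman_bound (t : nat) (w : Omega) : R :=
  if L * m%:R <= c * Num.sqrt t%:R then L * spread t t.+1 w
  else b t * m%:R * G ^+ 2 + (b t * m%:R)^-1 * spread t t.+1 w.

Lemma bregman_le_bound t w : (0 < t)%N -> (tau t w <= 2 * m)%N ->
  bregman f (x t.+1 w) (delayed t w) <= bregman_bound t w.
Proof.
move=> t0 tm.
have aE : anchor t t.+1 w = delayed t w.
  by rewrite /anchor /lag /delayed (minn_idPl tm) (minn_idPr _) //; lia.
have Xy := delayed_in w t0; have Xz := iterate_in w (ltn0Sn t).
rewrite /bregman_bound /spread aE; case: ifPn => _.
  exact: (bregman_smooth convf diff_f lipf Xz Xy).
apply: le_trans (bregman_lipschitz convf diff_f gradX Xz Xy) _.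
have l0 : 0 < b t * m%:R by rewrite mulr_gt0 // ltr0n.
rewrite -enorm_sqr; move: (enorm _) (b t * m%:R) l0 => e l l0.
rewrite -(ler_pM2l l0) mulrDr mulVKf ?gt_eqF //.
have := sqr_ge0 (l * G - e); nra.
Qed.

Lemma mean_bregman_bound t : (4 * m < t)%N ->
  mean_le (P := P) (bregman_bound t)
    (193 * (L * m%:R ^+ 2 * G ^+ 2 * beta t ^+ 2) + 48 * (sigma ^+ 2 * beta t)).
Proof.
move=> mt; have t0 : (0 < t)%N by lia.
have q1 : 1 <= m%:R :> R by rewrite ler1n.
have q0 : 0 < m%:R :> R by lra.
have mt2 : (2 * m < t)%N by lia.
have sA s k : (t - 2 * m <= s <= t)%N -> step s k <= 2 * b t.
  by move=> /andP[ts _]; rewrite stepE; exact: (step_window k L0 c0 mt ts).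
have := mean_spread mt2 sA => /=; set S0 := 2 * _ * _ => mS.
have [cA cB] := regime_bound (L := L) G sigma L0 q0 (b_gt0 t) (b_le t0).
have SS : mean_le (P := P) (spread t t.+1) (192 * (m%:R ^+ 2 * b t ^+ 2 * G ^+ 2)
    + 48 * (m%:R * b t ^+ 2 * sigma ^+ 2)).
  apply: mean_le_trans mS.
  rewrite /S0 natrD natrM.
  have bG : 0 <= b t ^+ 2 * G ^+ 2 by rewrite mulr_ge0 ?sqr_ge0.
  have bs : 0 <= b t ^+ 2 * sigma ^+ 2 by rewrite mulr_ge0 ?sqr_ge0.
  (* Constants of [mean_spread] for [M = 2 * m + 1] and [A = 2 * b t]; 192 and 48 are attained at
     [m = 1]. *)
  have e1 : (2 * (2 * m%:R + 1)) * ((2 * (2 * m%:R + 1) + 2) * 4) <=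
      192 * (m%:R ^+ 2 : R).
    nra.
  have e2 : (2 * (2 * m%:R + 1)) * 8 <= 48 * (m%:R : R) by lra.
  have f1 := ler_wpM2r bG e1; have f2 := ler_wpM2r bs e2.
  move: f1 f2; rewrite -!mulrA; lra.
have [Lm|Lm] := leP (L * m%:R) (c * Num.sqrt t%:R).
  have -> : bregman_bound t = fun w => L * spread t t.+1 w.
    by apply/funext => w; rewrite /bregman_bound Lm.
  apply: mean_le_trans (mean_leZ (ltW L0) SS); apply: cA.
  rewrite /b /alpha /Defs.eta addn0 ler_pdivrMr ?mul1r; last first.
    by rewrite ltr_pwDl // mulr_ge0 // ltW.
  by apply: le_trans Lm _; rewrite lerDr ltW.
have -> : bregman_bound t =
    fun w => b t * m%:R * G ^+ 2 + (b t * m%:R)^-1 * spread t t.+1 w.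
  by apply/funext => w; rewrite /bregman_bound leNgt Lm.
apply: mean_le_trans (mean_leD (mean_le_cst _) (mean_leZ _ SS)).
  apply: cB; rewrite /beta ler_pdivlMr ?mul1r ?ltW //.
  by rewrite mulr_gt0 // sqrt_gt0.
by rewrite invr_ge0 ltW // mulr_gt0.
Qed.

Lemma gap_le_diameter y : X y -> f y - f xstar <= G * r.
Proof.
move=> Xy; apply: le_trans (convex_gradient_le convf (diff_f Xy) Xy Xxstar) _.
apply: le_trans (dot_le_enorm _ _) _.
by rewrite ler_pM ?enorm_ge0 ?gradX ?distX.
Qed.

Let Delta t w := dot (x t w - xstar) (x t w - xstar).

Lemma gap_step t w : (0 < t)%N -> (tau t w <= 2 * m)%N ->
  f (x t.+1 w) - f xstar <=
    2^-1 * (L + c * Num.sqrt t%:R) * (Delta t w - Delta t.+1 w)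
    + 2^-1 * c * m%:R * r ^+ 2 * (Num.sqrt t%:R)^-1
    + (dot (noise t w) (x t w - xstar)
       + beta t / 2 * dot (noise t w) (noise t w) + bregman_bound t w).
Proof.
move=> t0 tm.
have := prox_descent convX convf diff_f (step0 (tau t w) t0) (sgd.2 t w t0)
  Xxstar (delayed_in w t0).
rewrite -/(noise t w) -/(Delta t w) -/(Delta t.+1 w) => /le_trans; apply.
have h1 := bregman_le_bound t0 tm.
have h2 : step t (tau t w) / 2 * dot (noise t w) (noise t w) <=
    beta t / 2 * dot (noise t w) (noise t w).
  rewrite ler_wpM2r ?dotvv_ge0 // ler_pM2r ?invr_gt0 //.
  apply: le_trans (b_le t0); rewrite stepE /b /alpha /Defs.eta addn0.
  have s0 : 0 <= Num.sqrt t%:R :> R := sqrtr_ge0 _.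
  have s1 : 0 <= Num.sqrt (t + tau t w)%:R :> R := sqrtr_ge0 _.
  rewrite lef_pV2 ?posrE ?ltr_pwDl ?mulr_ge0 ?(ltW c0) //.
  by rewrite lerD2l ler_pM2l // ler_wsqrtr // ler_nat leq_addr.
have h3 : (2 * step t (tau t w))^-1 = 2^-1 * (L + c * Num.sqrt (t + tau t w)%:R).
  by rewrite stepE /alpha /Defs.eta invfM invrK.
have D0 : 0 <= Delta t.+1 w := dotvv_ge0 _.
have D1 : Delta t w <= r ^+ 2 by apply: dist_star; exact: iterate_in.
have h4 := sqrt_shift_le (R := R) t0 tm.
have h5 : Num.sqrt t%:R <= Num.sqrt (t + tau t w)%:R :> R.
  by rewrite ler_wsqrtr // ler_nat leq_addr.
rewrite h3.
have h6 : 2^-1 * (L + c * Num.sqrt (t + tau t w)%:R) * (Delta t w - Delta t.+1 w)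
   <= 2^-1 * (L + c * Num.sqrt t%:R) * (Delta t w - Delta t.+1 w)
    + 2^-1 * c * m%:R * r ^+ 2 * (Num.sqrt t%:R)^-1.
  (* The difference of the two distances has no sign, but it is at most [r ^+ 2] and its weight [e]
     is nonnegative. *)
  pose e : R := Num.sqrt (t + tau t w)%:R - Num.sqrt t%:R.
  have e0 : 0 <= e by rewrite subr_ge0.
  have e1 : e <= m%:R / Num.sqrt t%:R by rewrite /e; lra.
  have : e * (Delta t w - Delta t.+1 w) <= m%:R / Num.sqrt t%:R * r ^+ 2.
    apply: (@le_trans _ _ (e * r ^+ 2)); first by rewrite ler_wpM2l //; lra.
    by rewrite ler_wpM2r ?sqr_ge0.
  move=> /(ler_wpM2l (ltW c0)).
  have -> : Num.sqrt (t + tau t w)%:R = e + Num.sqrt t%:R by rewrite /e subrK.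
  move: (Delta t w - Delta t.+1 w) (Num.sqrt t%:R) (m%:R) => D s q; lra.
lra.
Qed.

Let bracket t w := dot (noise t w) (x t w - xstar)
  + beta t / 2 * dot (noise t w) (noise t w) + bregman_bound t w.

(** The cross term has mean zero; 49 rounds up the 48 of the Bregman bound plus the half coming from
    [beta t / 2]. *)
Lemma mean_bracket t : (4 * m < t)%N -> mean_le (P := P) (bracket t)
  (193 * (L * m%:R ^+ 2 * G ^+ 2 / c ^+ 2) * t%:R^-1
   + 49 * (sigma ^+ 2 / c) * (Num.sqrt t%:R)^-1).
Proof.
move=> mt; have t0 : (0 < t)%N by lia.
have s0 := sqrt_gt0 t0.
have bE : beta t = c^-1 * (Num.sqrt t%:R)^-1 by rewrite /beta invfM.
have b2 : beta t ^+ 2 = (c ^+ 2)^-1 * t%:R^-1.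
  by rewrite bE exprMn -!exprVn [_ ^-1 ^+ 2 in X in _ * X]exprVn sqr_sqrtr.
have bb0 : 0 <= beta t by rewrite bE mulr_ge0 // invr_ge0 ltW.
have mv : measurable_fun setT ((fun w => x t w - xstar) : filt xi tau t -> borel_rV R d).
  by apply: measurable_subv; [exact: filt_iterate|exact: measurable_cst].
have vK w : dot (x t w - xstar) (x t w - xstar) <= r ^+ 2.
  by apply: dist_star; exact: iterate_in.
have h1 := mean_le_noise_cross t0 mv vK.
have h2 : 0 <= beta t / 2 by rewrite divr_ge0.
have h3 := mean_leD (mean_leD h1 (mean_leZ h2 (mean_le_noise_sqr t0)))
  (mean_bregman_bound mt).
apply: mean_le_trans h3; rewrite b2 add0r.
have : 0 <= sigma ^+ 2 * beta t by rewrite mulr_ge0 ?sqr_ge0.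
have -> : 49 * (sigma ^+ 2 / c) * (Num.sqrt t%:R)^-1 = 49 * (sigma ^+ 2 * beta t).
  by rewrite bE !mulrA.
rewrite -!mulrA; lra.
Qed.

Lemma gap_sum a T w : (0 < a)%N -> (forall t, (a <= t)%N -> (tau t w <= 2 * m)%N) ->
  \sum_(a <= t < T.+1) (f (x t.+1 w) - f xstar) <=
    2^-1 * (L + c * Num.sqrt T%:R) * r ^+ 2 + c * m%:R * r ^+ 2 * Num.sqrt T%:R
    + \sum_(a <= t < T.+1) bracket t w.
Proof.
move=> a0 H.
pose cf t : R := 2^-1 * (L + c * Num.sqrt t%:R).
apply: (@le_trans _ _ (\sum_(a <= t < T.+1) (cf t * (Delta t w - Delta t.+1 w)
    + 2^-1 * c * m%:R * r ^+ 2 * (Num.sqrt t%:R)^-1 + bracket t w))).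
  apply: ler_sum_nat => t /andP[at_ _].
  by apply: gap_step; [exact: leq_trans at_|exact: H].
rewrite !big_split /= lerD2r; apply: lerD.
  apply: abel_le => // t.
  - by rewrite /cf mulr_ge0 // addr_ge0 ?mulr_ge0 // ltW.
  - rewrite /cf ler_pM2l // lerD2l ler_pM2l // ler_wsqrtr // ler_nat //.
  - move=> t0; rewrite dotvv_ge0 /=; apply: dist_star; exact: iterate_in.
rewrite -mulr_sumr.
have k0 : 0 <= 2^-1 * c * m%:R * r ^+ 2.
  by rewrite !mulr_ge0 ?sqr_ge0 // ltW.
have := ler_wpM2l k0 (sum_inv_sqrt_le (R := R) T a0); lra.
Qed.

(** The running average moves towards each new iterate by a convex combination of two points, so
    two-point convexity gives both claims in one induction. *)
Lemma average_jensen T w : (0 < T)%N -> X (xbar x T w) /\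
  T%:R * f (xbar x T w) <= \sum_(1 <= t < T.+1) f (x t.+1 w).
Proof.
case: T => // T _; elim: T => [|T [XT fT]].
  by rewrite /xbar !big_nat1 invr1 scale1r mul1r; split=> //; exact: iterate_in.
have n0 : 0 < T.+2%:R :> R by rewrite ltr0n.
have nE : T.+2%:R = T.+1%:R + 1 :> R by rewrite natr1.
have XT2 : X (x T.+3 w) by exact: iterate_in.
have h0 : 0 <= T.+2%:R^-1 :> R by rewrite invr_ge0 ltW.
have h1 : T.+2%:R^-1 <= 1 :> R by rewrite invf_le1 // ler1n.
have xE : xbar x T.+2 w = xbar x T.+1 w + T.+2%:R^-1 *: (x T.+3 w - xbar x T.+1 w).
  rewrite convexE /xbar big_nat_recr //= scalerDr addrC; congr (_ + _).
  rewrite scalerA; congr (_ *: _).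
  rewrite nE; move: (T.+1%:R : R) (ltr0Sn R T) => a a0.
  by field; apply/andP; split; rewrite gt_eqF //; lra.
rewrite xE; split; first exact: convex_setE.
rewrite big_nat_recr //=.
have := convf XT XT2 h0 h1 => /(ler_wpM2l (ltW n0)) /le_trans; apply.
rewrite mulrDr mulrA mulfV ?gt_eqF // mul1r nE mulrDl mul1r.
move: fT; lra.
Qed.

Lemma gap_ge0 y : (forall z, X z -> f xstar <= f z) -> X y -> 0 <= f y - f xstar.
Proof. by move=> fmin /fmin; rewrite subr_ge0. Qed.

(** [f] is Lipschitz on [X] by convexity and the gradient bound. Reals are viewed as row vectors of
    length 1 to reuse the factorization lemma; [G + 1] makes the constant positive. *)
Lemma measurable_gap T : (0 < T)%N ->
  measurable_fun setT (fun w => f (xbar x T w) - f xstar).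
Proof.
move=> T0; apply: measurable_funB => //.
have mx : measurable_fun setT (xbar x T : Omega -> borel_rV R d).
  apply: measurable_vectorP => i.
  have -> : (fun w => xbar x T w 0 i) =
      (fun w => T%:R^-1 * \sum_(1 <= t < T.+1) x t.+1 w 0 i).
    by apply/funext => w; rewrite !mxE summxE.
  apply: measurable_funM => //; apply: measurable_sum => t.
  by apply: measurable_coord; exact: (filt_measurable (filt_iterate _)).
have := @measurable_lipschitz_factor R _ Omega d 1 (xbar x T)
  (fun w => const_mx (f (xbar x T w))) (G + 1).
move=> /(_ _ _ mx) => H.
have -> : (fun w => f (xbar x T w)) =
    (fun w => (const_mx (f (xbar x T w)) : 'rV[R]_1) 0 0).
  by apply/funext => w; rewrite mxE.
apply: measurable_coord; apply: H; first by rewrite ltr_pwDr.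
have lip y z : X y -> X z -> f y - f z <= (G + 1) * enorm (y - z).
  move=> Xy Xz; apply: le_trans (convex_gradient_le convf (diff_f Xy) Xy Xz) _.
  apply: le_trans (dot_le_enorm _ _) _; apply: ler_wpM2r; first exact: enorm_ge0.
  by have := gradX Xy; lra.
move=> w w'; have [Xw _] := average_jensen w T0; have [Xw' _] := average_jensen w' T0.
rewrite /enorm dotE big_ord1 !mxE -expr2 sqrtr_sqr ler_norml.
have := lip _ _ Xw Xw'; have := lip _ _ Xw' Xw.
rewrite (enormB (xbar x T w')) /enorm => *; apply/andP; split; lra.
Qed.

Hypothesis tau_late : forall t, (2 * m < t)%N -> P [set w | (2 * m < tau t w)%N] = 0%E.
Hypothesis fmin : forall z, X z -> f xstar <= f z.

Let late : set Omega :=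
  \bigcup_(t in [set t | (2 * m < t)%N]) [set w | (2 * m < tau t w)%N].

Let late0 : measurable late /\ P late = 0%E.
Proof.
have mt t : measurable [set w | (2 * m < tau t w)%N].
  have -> : [set w | (2 * m < tau t w)%N] = tau t @^-1` [set k | (2 * m < k)%N] by [].
  by rewrite -[X in measurable X]setTI; exact: measurable_funP.
have ml : measurable late by exact: bigcup_measurable.
split=> //; apply/negligibleP => //.
rewrite /late bigcup_mkcond; apply: negligible_bigcup => t.
case: ifPn => [|_]; last exact: negligible_set0.
by rewrite inE => /= tm; apply/negligibleP => //; exact: tau_late.
Qed.

Lemma mean_gap T : (0 < T)%N ->
  mean_le (P := P) (fun w => f (xbar x T w) - f xstar)
    (T%:R^-1 * (4 * m%:R * (G * r) + (2^-1 * (L + c * Num.sqrt T%:R) * r ^+ 2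
     + c * m%:R * r ^+ 2 * Num.sqrt T%:R)
     + (193 * (L * m%:R ^+ 2 * G ^+ 2 / c ^+ 2) * ln T%:R
     + 98 * (sigma ^+ 2 / c) * Num.sqrt T%:R))).
Proof.
move=> T0; have mh := measurable_gap T0.
have Tp : 0 < T%:R :> R by rewrite ltr0n.
have X_ w := (average_jensen w T0).1.
have h0 w : 0 <= f (xbar x T w) - f xstar by exact: gap_ge0.
have hB : exists B, forall w, f (xbar x T w) - f xstar <= B.
  by exists (G * r) => w; exact: gap_le_diameter.
have s0 : 0 <= Num.sqrt T%:R :> R := sqrtr_ge0 _.
have l0 : 0 <= ln T%:R :> R by rewrite ln_ge0 // ler1n.
have Gr : 0 <= G * r by exact: mulr_ge0.
have k1 : 0 <= L * m%:R ^+ 2 * G ^+ 2 / c ^+ 2.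
  apply: mulr_ge0; last by rewrite invr_ge0 sqr_ge0.
  exact: mulr_ge0 (mulr_ge0 (ltW L0) (sqr_ge0 _)) (sqr_ge0 _).
have k2 : 0 <= sigma ^+ 2 / c by rewrite divr_ge0 ?sqr_ge0 // ltW.
set Gam := _ + c * m%:R * r ^+ 2 * _.
have Gam0 : 0 <= Gam.
  apply: addr_ge0; last by rewrite !mulr_ge0 ?sqr_ge0 // ltW.
  by rewrite !mulr_ge0 ?sqr_ge0 // addr_ge0 ?mulr_ge0 // ltW.
(* For a short horizon the crude gap [G * r] is already below [T^-1 * (4 * m * (G * r))]. *)
have [Tm|mT] := leqP T (4 * m).
  apply: (mean_le_dom mh h0 _ hB) => [w|]; first exact: gap_le_diameter.
  apply: mean_le_trans (mean_le_cst _).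
  rewrite -(ler_pM2l Tp) mulVKf ?gt_eqF //.
  have Tm' : T%:R <= 4 * m%:R :> R by rewrite -natrM ler_nat.
  have := ler_wpM2r Gr Tm'; have := mulr_ge0 k1 l0; have := mulr_ge0 k2 s0.
  rewrite -!mulrA; lra.
have [ml Pl] := late0.
apply: (mean_le_ae ml Pl mh h0 hB (k := fun w => T%:R^-1 * (4 * m%:R * (G * r) + Gam +
    \sum_((4 * m).+1 <= t < T.+1) bracket t w))).
  move=> w Nw; have [_ J] := average_jensen w T0.
  rewrite -(ler_pM2l Tp) mulVKf ?gt_eqF // mulrBr.
  have tw t : ((4 * m).+1 <= t)%N -> (tau t w <= 2 * m)%N.
    move=> mt; rewrite leqNgt; apply/negP => tt.
    apply: Nw; exists t => //=; apply: leq_ltn_trans mt.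
    by rewrite leq_mul2r orbT.
  have S1 := @gap_sum (4 * m).+1 T w isT tw.
  have S2 : \sum_(1 <= t < (4 * m).+1) (f (x t.+1 w) - f xstar) <= 4 * m%:R * (G * r).
    apply: (@le_trans _ _ (\sum_(1 <= t < (4 * m).+1) G * r)).
      by apply: ler_sum_nat => t _; apply: gap_le_diameter; exact: iterate_in.
    by rewrite sumr_const_nat subn1 /= -[leLHS]mulr_natl natrM.
  have S3 : \sum_(1 <= t < T.+1) f (x t.+1 w) - T%:R * f xstar =
      \sum_(1 <= t < T.+1) (f (x t.+1 w) - f xstar).
    by rewrite sumrB sumr_const_nat subn1 /= mulr_natl.
  apply: (@le_trans _ _ (\sum_(1 <= t < T.+1) (f (x t.+1 w) - f xstar))).
    by rewrite -S3 lerD2r.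
  rewrite (@big_cat_nat _ _ _ (4 * m).+1) //=; last by rewrite ltnS ltnW.
  rewrite -addrA; apply: lerD => //.
apply: mean_leZ; first by rewrite invr_ge0 ltW.
apply: mean_leD; first exact: mean_le_cst.
have hs := mean_le_sum (fun t (ht : ((4 * m).+1 <= t < T.+1)%N) =>
  mean_bracket (proj1 (andP ht))).
apply: mean_le_trans hs.
rewrite big_split /= -!mulr_sumr; apply: lerD.
  apply: ler_wpM2l; first lra.
  by apply: sum_inv_le_ln; rewrite ltnS muln_gt0 m0.
(* The sum of inverse square roots doubles 49 into 98. *)
have k3 : 0 <= 49 * (sigma ^+ 2 / c) by lra.
have := ler_wpM2l k3 (sum_inv_sqrt_le (R := R) T (ltn0Sn (4 * m))); lra.
Qed.

End oracle_noise.

(** * From the hypotheses of the theorem to those of the analysis *)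

Lemma uniform_delays_late (R : realType) (d0 : measure_display)
    (Omega : measurableType d0) (P : probability Omega R) (m : nat)
    (tau : nat -> {RV P >-> nat}) t : uniform_delays m tau -> (2 * m < t)%N ->
  P [set w | (2 * m < tau t w)%N] = 0%E.
Proof.
move=> [_ unif] mt; pose F k := tau t @^-1` [set k].
have mF k : measurable (F k).
  by rewrite -[X in measurable X]setTI; exact: measurable_funP.
have tF : trivIset setT F.
  by move=> i j _ _ [w [/= <- <-]].
have PU : P (\big[setU/set0]_(k < 2 * m + 1) F k) =
    (\sum_(k < 2 * m + 1) P (F k))%E by exact: measure_bigsetU.
(* The [2 * m + 1] prescribed masses already add up to 1, so all larger values are null. *)
have {}PU : P (\big[setU/set0]_(k < 2 * m + 1) F k) = 1%E.
  rewrite PU (eq_bigr (fun=> ((2 * m + 1)%:R^-1)%:E)) => [|k _]; last first.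
    by apply: unif => //; move: (nat_of_ord k) (ltn_ord k) => j; rewrite addn1 ltnS.
  by rewrite sumEFin sumr_const card_ord -[X in X%:E]mulr_natr mulVf //.
have -> : [set w | (2 * m < tau t w)%N] = ~` \big[setU/set0]_(k < 2 * m + 1) F k.
  rewrite -bigcup_mkord; apply/seteqP; split=> w /=.
    by move=> mw [k /= km kw]; move: km mw; rewrite -kw addn1 ltnS leqNgt => /negP.
  move=> H; rewrite ltnNge; apply/negP => wm; apply: H.
  by exists (tau t w) => //=; rewrite addn1 ltnS.
rewrite probability_setC; last exact: bigsetU_measurable.
by rewrite PU subee.
Qed.

Lemma objective_convex (R : realType) d dX (Xi : measurableType dX)
    (Q : probability Xi R) (X : set 'rV[R]_d) (F : 'rV[R]_d -> Xi -> R) :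
  convex_set X -> (forall s, convex_function X (F^~ s)) ->
  (forall y, X y -> Q.-integrable setT (EFin \o F y)) ->
  conv_on X (objective Q F).
Proof.
move=> cX cF iF y z h Xy Xz h0 h1.
have fE u : objective Q F u = \int[Q]_s F u s by rewrite /objective unlock.
have Xv := convex_setE cX Xy Xz h0 h1.
have i1 : Q.-integrable setT (EFin \o (fun s => F z s - F y s)).
  exact: (integrableB measurableT (iF _ Xz) (iF _ Xy)).
have i2 : Q.-integrable setT (EFin \o (fun s => h * (F z s - F y s))).
  exact: (integrableZl measurableT h i1).
have i3 : Q.-integrable setT (EFin \o (fun s => F y s + h * (F z s - F y s))).
  exact: (integrableD measurableT (iF _ Xy) i2).
rewrite !fE -(RintegralB measurableT (iF _ Xz) (iF _ Xy)).
rewrite -(RintegralZl h measurableT i1) -(RintegralD measurableT (iF _ Xy) i2).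
apply: le_Rintegral => // [|s _]; first exact: iF.
exact: (convex_functionE (cF s)).
Qed.

(* The radius written R in the source is r here; R is the field of reals. *)
Theorem corollary3p2 (R : realType) :
  exists2 C : R, 0 < C &
  forall (d : nat) (dO dX : measure_display)
    (Omega : measurableType dO) (P : probability Omega R)
    (Xi : measurableType dX) (Q : probability Xi R)
    (X : set 'rV[R]_d) (F : 'rV[R]_d -> Xi -> R)
    (xstar x1 : 'rV[R]_d) (L sigma r G c : R) (taubar : nat)
    (xi : nat -> {RV P >-> Xi}) (tau : nat -> {RV P >-> nat})
    (x : nat -> Omega -> 'rV[R]_d),
  let f := objective Q F in
  (* the constants *)
  0 < L -> 0 <= sigma -> 0 <= r -> 0 <= G -> 0 < c -> (0 < taubar)%N ->
  (* the problem *)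
  X !=set0 -> compact X -> convex_set X ->
  (forall s, convex_function X (F^~ s)) ->
  (forall s y, X y -> differentiable (F^~ s) y) ->
  (forall y, X y -> Q.-integrable setT (EFin \o F y)) ->
  measurable_fun (X `*` setT : set (borel_rV R d * Xi))
    (fun z : borel_rV R d * Xi => grad (F^~ z.2) z.1 : borel_rV R d) ->
  argmin X f xstar ->
  (* smoothness, variance, radius and gradient bounds *)
  (forall y, X y -> differentiable f y) ->
  (forall y z, X y -> X z -> enorm (grad f y - grad f z) <= L * enorm (y - z)) ->
  (forall y, X y ->
    ('E_Q[fun s => (enorm (grad f y - grad (F^~ s) y) ^+ 2)%R] <= (sigma ^+ 2)%:E)%E) ->
  (forall y, X y -> enorm (y - xstar) <= r) ->
  (forall y, X y -> enorm (grad f y) <= G) ->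
  (* unbiasedness of the stochastic gradients *)
  (forall y, X y -> forall i : 'I_d,
    ('E_Q[fun s => grad (F^~ s) y ord0 i] = (grad f y ord0 i)%:E)%E) ->
  (* samples and delays *)
  (forall t, (0 < t)%N -> forall A, measurable A ->
    distribution P (xi t) A = Q A) ->
  mutually_independent P positive_time
    (sample_delay_sigma xi tau) ->
  uniform_delays taubar tau ->
  (* the iteration *)
  X x1 ->
  delayed_sgd X F (alpha L c) x1 xi tau x ->
  forall T : nat, (0 < T)%N ->
  (`| 'E_P[fun w => (f (xbar x T w) - f xstar)%R] |
   <= (C * (D1 c sigma r taubar * (Num.sqrt T%:R / T%:R)
            + D2 L c G taubar * (ln T%:R / T%:R)
            + D3 L c r G taubar * (1 / T%:R)))%:E)%E.
Proof.
exists 300 => // d dO dX Omega P Xi Q X F xstar x1 L sigma r G c m xi tau x f.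
move=> L0 sigma0 r0 G0 c0 m0 X0 compX convX cF _ iF measF [Xs fmin] diff_f lipf
  varF distX gradX unbF lawxi indep unif Xx1 sgd T T0.
have step0 t k : (0 < t)%N -> 0 < alpha L c t k.
  by move=> _; rewrite invr_gt0 ltr_pwDl // mulr_ge0 // ltW.
have convf : conv_on X f := objective_convex convX cF iF.
have late t : (2 * m < t)%N -> P [set w | (2 * m < tau t w)%N] = 0%E.
  exact: uniform_delays_late.
have [tau_lt _] := unif.
have [_ mg] := mean_gap L0 sigma0 step0 compX convX measF lipf varF unbF lawxi indep
  tau_lt Xx1 sgd G0 r0 convf diff_f Xs distX gradX c0 m0 (erefl _) late fmin T0.
(* The averaged point lies in [X], so its gap is nonnegative and the absolute value disappears. *)
rewrite unlock gee0_abs; last first.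
  apply: integral_ge0 => w _; rewrite lee_fin subr_ge0; apply: fmin.
  by have [] := average_jensen convX Xx1 sgd convf w T0.
by apply: le_trans mg _; rewrite lee_fin rate_bound.
Qed.
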